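(* Let $n \in \mathbb{N}$, $s \in \mathbb{N}$ with $s \geq 2$, and $k_0, k_1 \in \mathbb{R}$. There exists $N = N(n,k_0,k_1,s) > 0$ (depending only on $n,k_0,k_1,s$) such that the following holds. Let $0<T<\infty$ and let $u:\mathbb{R}^n \times [0,T] \to \mathbb{R}$ be a smooth solution of the biharmonic heat flow $\frac{\partial}{\partial t} u = -\Delta^2 u$ on $\mathbb{R}^n\times[0,T]$ which satisfies $$\left( |\nabla^s u| + |\nabla^{s-1} u|^{s/(s-1)} + \ldots + |\nabla u|^{s} \right)(x,t) \leq \frac{k_0}{t^{s/4}} \quad \text{for all } t \in [0,T],\ x \in \mathbb{R}^n,$$ and $$\sup_{B_1(0)} \sum_{i=0}^{2n+s+1} |\nabla^i u_0|^2 \leq k_1 < \infty,$$ where $u_0(\cdot) := u(\cdot,0)$. Then $$\left( |\nabla^s u| + |\nabla^{s-1} u|^{s/(s-1)} + \ldots + |\nabla u|^{s} \right)(x,t) \leq \frac{N}{(1-|x|)^{s}}$$ for all $x,t$ which satisfy $x \in \overline{B_1(0)}$, $(1-|x|)^4 \geq Nt$, $t \leq \frac{1}{N}$ and $t \leq T$ (with $t\ge 0$).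
   Context: The sum $|\nabla^s u| + |\nabla^{s-1} u|^{s/(s-1)} + \ldots + |\nabla u|^{s}$ is $\sum_{r=1}^{s} |\nabla^r u|^{s/r}$. $B_r(x)$ is the ball of radius $r$ about $x$ in $\mathbb{R}^n$. $\Delta$ is the spatial Laplacian, $\Delta^2=\Delta\Delta$. $\nabla^i u(x,t)$ is the full $i$-th spatial derivative (the tensor of all $i$-th order partial derivatives, with $\nabla^0 u = u$), and $|\nabla^i u|$ is its standard norm, e.g. $|\nabla^2 u|^2 = \sum_{i,j=1}^n |\nabla_i\nabla_j u|^2$. ''Smooth'' on $\mathbb{R}^n\times[0,T]$ means smooth in space and time up to and including $t=0$. Convention: $M/0 = \infty$ for $M>0$; the hypothesis with right-hand side $k_0/t^{s/4}$ is understood after multiplying by $t^{s/4}$. *)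

(* Defs.v *)
From mathcomp Require Import all_boot all_order all_algebra.
From mathcomp Require Import all_classical all_reals all_analysis.

Set Implicit Arguments.
Unset Strict Implicit.
Unset Printing Implicit Defensive.

Import Order.TTheory GRing.Theory Num.Theory.
Import numFieldNormedType.Exports.

Local Open Scope classical_set_scope.
Local Open Scope ring_scope.

(* The library norm on row vectors is the sup norm, so the Euclidean norm and
   its balls are defined here; the topology of 'rV[R]_n is the same. *)
Definition enorm (R : realType) (n : nat) (x : 'rV[R]_n) : R :=
  Num.sqrt (\sum_(j < n) x 0 j ^+ 2).

Definition eball (R : realType) (n : nat) (c : 'rV[R]_n) (r : R) :
    set 'rV[R]_n :=
  [set x | enorm (x - c) < r].

Definition partial (R : realType) (n : nat) (j : 'I_n) (f : 'rV[R]_n -> R) :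
    'rV[R]_n -> R :=
  'D_(delta_mx 0 j) f.

Definition partials (R : realType) (n : nat) (J : seq 'I_n)
    (f : 'rV[R]_n -> R) : 'rV[R]_n -> R :=
  foldr (@partial R n) f J.

(* |nabla^i f|(x): the tensor nabla^i f has one entry per i-tuple of
   directions. *)
Definition grad_norm (R : realType) (n i : nat) (f : 'rV[R]_n -> R)
    (x : 'rV[R]_n) : R :=
  Num.sqrt (\sum_(J : i.-tuple 'I_n) partials J f x ^+ 2).

(* |nabla^s f| + |nabla^(s-1) f|^(s/(s-1)) + ... + |nabla f|^s, with real
   exponents s/r. *)
Definition grad_sum (R : realType) (n s : nat) (f : 'rV[R]_n -> R)
    (x : 'rV[R]_n) : R :=
  \sum_(1 <= r < s.+1) grad_norm r f x `^ (s%:R / r%:R).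

Definition laplacian (R : realType) (n : nat) (f : 'rV[R]_n -> R) :
    'rV[R]_n -> R :=
  fun x => \sum_(j < n) partial j (partial j f) x.

Section Spacetime.
Context {R : realType} {n : nat}.
Implicit Types (T t : R) (x : 'rV[R]_n) (u w : 'rV[R]_n -> R -> R).

(* A function on R^n x [0, T] is represented by a total w; the notions below
   only read its values at times in [0, T].  The time derivative is therefore
   a limit inside [0, T], hence one-sided at t = 0 and t = T. *)
Definition time_slope w x t : R -> R := fun tau => (w x tau - w x t) / (tau - t).

Definition time_derivable T w x t : Prop :=
  cvg (time_slope w x t @ within `[0, T] t^').

Definition time_deriv T w x t : R :=
  lim (time_slope w x t @ within `[0, T] t^').

(* Space-time directions: Some j is the j-th space direction, None is time. *)
Definition st_derivable T (d : option 'I_n) w x t : Prop :=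
  if d is Some j then derivable (w^~ t) x (delta_mx 0 j)
  else time_derivable T w x t.

Definition st_partial T (d : option 'I_n) w : 'rV[R]_n -> R -> R :=
  fun x t => if d is Some j then partial j (w^~ t) x else time_deriv T w x t.

Definition st_partials T (D : seq (option 'I_n)) w : 'rV[R]_n -> R -> R :=
  foldr (st_partial T) w D.

(* C^infty on R^n x [0, T], up to and including the boundary times: all
   iterated space-time partial derivatives exist and are jointly continuous. *)
Definition smooth_on T u : Prop :=
  forall D : seq (option 'I_n),
    {within [set p : 'rV[R]_n * R | 0 <= p.2 <= T],
       continuous (fun p => st_partials T D u p.1 p.2)} /\
    forall (d : option 'I_n) x t, 0 <= t <= T ->
      st_derivable T d (st_partials T D u) x t.

Definition biharmonic_heat_flow T u : Prop :=
  smooth_on T u /\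
  forall x t, 0 <= t <= T ->
    time_deriv T u x t = - laplacian (laplacian (u^~ t)) x.

End Spacetime.

(* Main.v *)
(* The estimate is an interior energy estimate for the linear flow.  Rescale by
   sg = (1 - |x0|) / (n + 1) about x0, so that the cube [-1, 1]^n corresponds to
   a cube inside the unit ball, and use the cutoff zeta = prod_i (1 - x_i^2).
   Put H_i = int zeta^(2i) |nabla^i u|^2 and E_i = int zeta^(2i+4) |nabla^i u|^2.
   Integrating by parts, E_i' <= - H_(i+2) + C (H_(i+1) + H_i), and H_2 is
   interpolated between H_3 and H_1; so for suitable weights A_i > 0 the sum of
   A_i E_i has derivative at most K H_1.  The hypothesis for |nabla u| gives
   H_1 <= k / sqrt t, which is integrable in time, hence the weighted sum stays
   bounded for t <= 1, and a Sobolev inequality turns this into pointwise bounds.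

   No integral is needed: int is replaced by the average over a uniform grid of
   mesh 1 / (m + 1), integration by parts then holds up to an error O(1 / m),
   uniformly in time, and m tends to infinity at the end. *)

Require Import Defs.
From mathcomp Require Import all_boot all_order all_algebra.
From mathcomp Require Import all_classical all_reals all_analysis.
From mathcomp Require Import ring lra.
Import Order.TTheory GRing.Theory Num.Theory.
Import numFieldNormedType.Exports.
Local Open Scope classical_set_scope.
Local Open Scope ring_scope.

Set Implicit Arguments.
Unset Strict Implicit.
Unset Printing Implicit Defensive.

(** * Grid averages and integration by parts *)

(** For order r the hypothesis gives |nabla^r u|^2 <= C t^(-r/2), which is integrable at t = 0 only
    for r = 1. Hence H_1 is the only term that may be left in the time derivative, the energies
    start at i = 1, and all higher terms must be absorbed by dissipation. E_i dissipates H_(i+2), so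
    the bad terms H_(i+1) and H_i of E_i' are paid for by the energies of lower order, provided A_i
    is small compared with the earlier weights. No energy dissipates H_2, which is why only this one
    has to be interpolated.

    One constant serves every x0, because sqrt t |nabla u|^2 is invariant under the rescaling and
    the bound on the initial data can only improve when sg <= 1.

    The order of quantifiers shapes the statements: weights and constants are chosen before the
    solution, whereas the constants in the O(1 / m) errors depend on the solution, the point and the
    scale, and vanish only in the limit. The Sobolev inequality is of L^1 type and costs one
    derivative per coordinate, so derivatives up to order s + n enter. *)

Section Grid.
Context {R : realType} {n : nat}.
Implicit Types (x : 'rV[R]_n) (i j : 'I_n) (f g : 'rV[R]_n -> R).
Implicit Types (L : seq 'I_n) (m : nat).

Definition box x : Prop := forall i, -1 <= x 0 i <= 1.

Definition upd x j (z : R) : 'rV[R]_n := \row_i (if i == j then z else x 0 i).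

Definition node m (k : nat) : R := k%:R * m.+1%:R^-1 - 1.

(** Left Riemann sum for the mean over [-1, 1] in coordinate [j], with one node per increment so
    that differences telescope. Taking the mean instead of the integral keeps constants unchanged in
    every dimension. *)
Definition av m j f x : R :=
  m.+1%:R^-1 / 2 * \sum_(k < 2 * m.+1) f (upd x j (node m k)).

Definition avs m L f : 'rV[R]_n -> R := foldr (av m) f L.

Lemma upd_coord x j z : upd x j z 0 j = z.
Proof. by rewrite mxE eqxx. Qed.

Lemma upd_other x j z i : i != j -> upd x j z 0 i = x 0 i.
Proof. by move=> /negPf ij; rewrite mxE ij. Qed.

Lemma upd_upd x j y z : upd (upd x j y) j z = upd x j z.
Proof. by apply/rowP => i; rewrite !mxE; case: eqP. Qed.

Lemma upd_id x j : upd x j (x 0 j) = x.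
Proof. by apply/rowP => i; rewrite !mxE; case: eqP => [->|]. Qed.

Lemma upd_comm x i j y z : i != j -> upd (upd x i y) j z = upd (upd x j z) i y.
Proof.
move=> ij; apply/rowP => k; rewrite !mxE.
by case: (eqVneq k j) => [->|//]; rewrite eq_sym (negPf ij).
Qed.

Lemma box_upd x j z : box x -> -1 <= z <= 1 -> box (upd x j z).
Proof. by move=> bx zb i; rewrite mxE; case: eqP. Qed.

Lemma box0 : box 0.
Proof. by move=> i; rewrite mxE lerN10 ler01. Qed.

Lemma node0 m : node m 0 = -1.
Proof. by rewrite /node mul0r sub0r. Qed.

Lemma node_last m : node m (2 * m.+1) = 1.
Proof. by rewrite /node natrM mulfK ?pnatr_eq0 //; lra. Qed.

Lemma nodeS m k : node m k.+1 = node m k + m.+1%:R^-1.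
Proof. by rewrite /node -[k.+1%:R]natr1 mulrDl mul1r addrAC. Qed.

Lemma step_gt0 m : 0 < m.+1%:R^-1 :> R.
Proof. by rewrite invr_gt0 ltr0n. Qed.

Lemma step_le1 m : m.+1%:R^-1 <= 1 :> R.
Proof. by rewrite invf_le1 ?ltr0n // ler1n. Qed.

Lemma node_itv m k : (k <= 2 * m.+1)%N -> -1 <= node m k <= 1.
Proof.
move=> km; apply/andP; split.
  by rewrite /node lerBrDr addrC subrr mulr_ge0 // ltW ?step_gt0.
by rewrite -[leRHS](node_last m) /node lerD2r ler_pM2r ?step_gt0 // ler_nat.
Qed.

Lemma box_node x j m k : (k <= 2 * m.+1)%N -> box x -> box (upd x j (node m k)).
Proof. by move=> km bx; apply: box_upd => //; exact: node_itv. Qed.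

Lemma av_le m j f g x : (forall y, box y -> f y <= g y) -> box x ->
  av m j f x <= av m j g x.
Proof.
move=> fg bx; rewrite /av ler_wpM2l ?divr_ge0 ?(ltW (step_gt0 m)) //.
by apply: ler_sum => k _; apply/fg/box_node => //; exact: ltnW.
Qed.

Lemma avs_le m L f g x : (forall y, box y -> f y <= g y) -> box x ->
  avs m L f x <= avs m L g x.
Proof. by elim: L x => [|j L IH] x fg bx /=; [exact: fg|apply: av_le => // y; exact: IH]. Qed.

Lemma av_cst m j c x : av m j (fun=> c) x = c.
Proof.
rewrite /av sumr_const card_ord -[c *+ _]mulr_natl natrM.
have := step_gt0 m; set h := (_)%:R^-1 => h0.
rewrite (_ : m.+1%:R = h^-1); last by rewrite /h invrK.
by field; rewrite gt_eqF.
Qed.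

Lemma avs_cst m L c x : avs m L (fun=> c) x = c.
Proof.
elim: L x => [//|j L IH] x /=.
by rewrite (_ : avs m L (fun=> c) = fun=> c) ?av_cst //; apply/funext.
Qed.

Lemma avD m j f g : av m j (fun x => f x + g x) = fun x => av m j f x + av m j g x.
Proof. by apply/funext => x; rewrite /av big_split mulrDr. Qed.

Lemma avsD m L f g : avs m L (fun x => f x + g x) = fun x => avs m L f x + avs m L g x.
Proof. by elim: L => [//|j L /= ->]; rewrite avD. Qed.

Lemma avZ m j c f : av m j (fun x => c * f x) = fun x => c * av m j f x.
Proof. by apply/funext => x; rewrite /av -mulr_sumr mulrCA. Qed.

Lemma avsZ m L c f : avs m L (fun x => c * f x) = fun x => c * avs m L f x.
Proof. by elim: L => [//|j L /= ->]; rewrite avZ. Qed.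

Lemma avs_sum m L (K : Type) (r : seq K) (P : pred K) (F : K -> 'rV[R]_n -> R) :
  avs m L (fun x => \sum_(k <- r | P k) F k x) =
  fun x => \sum_(k <- r | P k) avs m L (F k) x.
Proof.
elim: r => [|k r IH].
  by apply/funext => x; under eq_fun do rewrite big_nil; rewrite avs_cst big_nil.
under eq_fun do rewrite big_cons; under [RHS]eq_fun do rewrite big_cons.
by case: (P k); rewrite ?avsD IH.
Qed.

Lemma avs_norm m L f x : `|avs m L f x| <= avs m L (fun y => `|f y|) x.
Proof.
elim: L x => [//|j L IH] x /=; rewrite /av normrM ger0_norm; last first.
  by rewrite divr_ge0 ?(ltW (step_gt0 m)).
rewrite ler_wpM2l ?divr_ge0 ?(ltW (step_gt0 m)) //.
by apply: (le_trans (ler_norm_sum _ _ _)); exact: ler_sum.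
Qed.

Lemma av_swap m i j f : av m i (av m j f) = av m j (av m i f).
Proof.
have [->//|ij] := eqVneq i j; apply/funext => x; rewrite /av.
rewrite -!mulr_sumr exchange_big /=; congr (_ * (_ * _)).
by apply: eq_bigr => k _; apply: eq_bigr => l _; rewrite upd_comm.
Qed.

(** Averages in different coordinates commute, so the one in direction [j] can be made innermost,
    where one-variable integration by parts applies. *)
Lemma avs_rem m L j f : j \in L -> avs m L f = avs m (rem j L) (av m j f).
Proof.
have avC L' : av m j (avs m L' f) = avs m L' (av m j f).
  by elim: L' => //= i L' <-; rewrite av_swap.
elim: L => [//|i L IH]; rewrite inE /=; case: (eqVneq i j) => [->|ij] /= jL.
  exact: avC.
by rewrite IH //; move: jL; rewrite eq_sym (negPf ij).
Qed.

(** All coordinates are overwritten by nodes, so the base point 0 does not affect the value. *)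
Definition Int m f : R := avs m (enum 'I_n) f 0.

Lemma Int_le m f g : (forall x, box x -> f x <= g x) -> Int m f <= Int m g.
Proof. by move=> fg; apply: avs_le => //; exact: box0. Qed.

Lemma Int_ge0 m f : (forall x, box x -> 0 <= f x) -> 0 <= Int m f.
Proof. by move=> f0; rewrite -(avs_cst m (enum 'I_n) 0 0); exact: Int_le. Qed.

Lemma IntD m f g : Int m (fun x => f x + g x) = Int m f + Int m g.
Proof. by rewrite /Int avsD. Qed.

Lemma IntZ m c f : Int m (fun x => c * f x) = c * Int m f.
Proof. by rewrite /Int avsZ. Qed.

Lemma Int_sum m (K : Type) (r : seq K) (P : pred K) (F : K -> 'rV[R]_n -> R) :
  Int m (fun x => \sum_(k <- r | P k) F k x) = \sum_(k <- r | P k) Int m (F k).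
Proof. by rewrite /Int avs_sum. Qed.

End Grid.

(** * Uniform first-order expansions and errors of order 1 / m *)

Section Dif.
Context {R : realType} {n : nat} {I : Type}.
Implicit Types (g dg : I -> 'rV[R]_n -> R) (j : 'I_n).

(* First-order expansions with quadratic error on the box, uniform in the
   parameter, replace differentiability: this is what Riemann sums need. *)
Definition dif j g dg : Prop := exists M : R, forall p x, box x ->
  [/\ `|g p x| <= M, `|dg p x| <= M &
    forall z : R, -1 <= z <= 1 ->
      `|g p (upd x j z) - g p x - (z - x 0 j) * dg p x| <= M * (z - x 0 j) ^+ 2].

Lemma dif_cst j (c : R) : dif j (fun _ _ => c) (fun _ _ => 0).
Proof.
exists `|c| => p x bx; split; rewrite ?normr0 // => z _.
by rewrite subrr mulr0 subr0 normr0 mulr_ge0 // sqr_ge0.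
Qed.

Lemma dif_coord j k :
  dif j (fun _ (x : 'rV[R]_n) => x 0 k) (fun _ _ => (k == j)%:R).
Proof.
exists 1 => p x bx; split => [||z zb].
- by rewrite ler_norml bx.
- by case: (k == j); rewrite ?normr1 ?normr0 ?ler01.
- rewrite mul1r [upd _ _ _ _ _]mxE; have [->|kj] := eqVneq k j.
    by rewrite mulr1 subrr normr0 sqr_ge0.
  by rewrite mulr0 subr0 subrr normr0 sqr_ge0.
Qed.

Lemma difD j f df g dg : dif j f df -> dif j g dg ->
  dif j (fun p x => f p x + g p x) (fun p x => df p x + dg p x).
Proof.
move=> [M Mf] [M' Mg]; exists (M + M') => p x bx.
have [f1 f2 f3] := Mf p x bx; have [g1 g2 g3] := Mg p x bx; split.
- by apply: (le_trans (ler_normD _ _)); exact: lerD.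
- by apply: (le_trans (ler_normD _ _)); exact: lerD.
- move=> z zb /=; rewrite [leRHS]mulrDl.
  have := f3 z zb; have := g3 z zb; set a := (z - _) => ga fa.
  rewrite (_ : _ - _ = (f p (upd x j z) - f p x - a * df p x) +
    (g p (upd x j z) - g p x - a * dg p x)); last by ring.
  by apply: (le_trans (ler_normD _ _)); rewrite lerD.
Qed.

Lemma difM j f df g dg : dif j f df -> dif j g dg ->
  dif j (fun p x => f p x * g p x) (fun p x => df p x * g p x + f p x * dg p x).
Proof.
move=> [M Mf] [M' Mg].
exists (8 * (`|M| + 1) * (`|M'| + 1)) => p x bx.
have [f1 f2 f3] := Mf p x bx; have [g1 g2 g3] := Mg p x bx.
have M0 : 0 <= M by apply: le_trans f1; exact: normr_ge0.
have M'0 : 0 <= M' by apply: le_trans g1; exact: normr_ge0.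
rewrite (ger0_norm M0) (ger0_norm M'0).
have MM : 0 <= M * M' by exact: mulr_ge0.
split.
- rewrite normrM; have := ler_pM (normr_ge0 _) (normr_ge0 _) f1 g1; lra.
- apply: (le_trans (ler_normD _ _)); rewrite !normrM.
  have := ler_pM (normr_ge0 _) (normr_ge0 _) f2 g1.
  have := ler_pM (normr_ge0 _) (normr_ge0 _) f1 g2; lra.
- move=> z zb /=; have := f3 z zb; have := g3 z zb.
  have [g1' _ _] := Mg p (upd x j z) (box_upd j bx zb).
  (* This bound turns the cubic remainder, a first-order term times a quadratic error, into a
     quadratic one. *)
  have a2 : `|z - x 0 j| <= 2 by have := bx j; rewrite ler_norml; lra.
  set a := z - x 0 j in a2 *; set F := f p _; set F' := f p x.
  set G := g p (upd _ _ _) in g1' *; set G' := g p x => gr fr.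
  rewrite (_ : _ - _ = (F - F' - a * df p x) * G + F' * (G - G' - a * dg p x)
     + a * df p x * ((G - G' - a * dg p x) + a * dg p x)); last by ring.
  have A0 : 0 <= a ^+ 2 by exact: sqr_ge0.
  have MA : 0 <= M * a ^+ 2 by exact: mulr_ge0.
  have M'A : 0 <= M' * a ^+ 2 by exact: mulr_ge0.
  have MMA : 0 <= M * M' * a ^+ 2 by exact: mulr_ge0.
  have e1 : `|(F - F' - a * df p x) * G| <= M * a ^+ 2 * M' by rewrite normrM ler_pM.
  have e2 : `|F' * (G - G' - a * dg p x)| <= M * (M' * a ^+ 2) by rewrite normrM ler_pM.
  have e3 : `|a * df p x * (G - G' - a * dg p x)| <= 2 * M * (M' * a ^+ 2).
    by rewrite !normrM ler_pM // ?mulr_ge0 // ler_pM.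
  have e4 : `|a * df p x * (a * dg p x)| <= M * M' * a ^+ 2.
    rewrite (_ : _ * _ = df p x * dg p x * a ^+ 2); last by ring.
    by rewrite normrM normrM [`|a ^+ 2|]ger0_norm // ler_wpM2r // ler_pM.
  rewrite [a * df p x * (_ + _)]mulrDr.
  apply: (le_trans (ler_normD _ _)).
  have := ler_normD ((F - F' - a * df p x) * G) (F' * (G - G' - a * dg p x)).
  have := ler_normD (a * df p x * (G - G' - a * dg p x)) (a * df p x * (a * dg p x)).
  lra.
Qed.

Lemma dif_ext j g dg g' dg' :
  (forall p x, g p x = g' p x) -> (forall p x, dg p x = dg' p x) ->
  dif j g dg -> dif j g' dg'.
Proof.
by move=> gg dd [M H]; exists M => p x bx; rewrite -gg -dd;
  have [a b c] := H p x bx; split => // z zb; rewrite -gg; exact: c.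
Qed.

Lemma difZ j c g dg : dif j g dg ->
  dif j (fun p x => c * g p x) (fun p x => c * dg p x).
Proof.
move=> dg_; apply: dif_ext (difM (dif_cst j c) dg_) => // p x.
by rewrite mul0r add0r.
Qed.

Lemma difX j g dg k : dif j g dg ->
  dif j (fun p x => g p x ^+ k) (fun p x => k%:R * g p x ^+ k.-1 * dg p x).
Proof.
move=> d; elim: k => [|k IH].
  by apply: dif_ext (dif_cst j 1) => // p x; rewrite !mul0r.
apply: dif_ext (difM d IH) => p x; rewrite ?exprS // -natr1.
by case: k {IH} => [|k] /=; rewrite ?expr0 ?exprS; ring.
Qed.

Lemma dif_bound j g dg : dif j g dg -> exists2 M : R, 0 <= M &
  forall p x, box x -> [/\ `|g p x| <= M, `|dg p x| <= M &
    forall z : R, -1 <= z <= 1 ->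
      `|g p (upd x j z) - g p x - (z - x 0 j) * dg p x| <= M * (z - x 0 j) ^+ 2].
Proof.
move=> [M H]; exists `|M| => // p x bx; have [a b c] := H p x bx.
split=> [||z zb]; [exact: le_trans (ler_norm _)|exact: le_trans (ler_norm _)|].
by apply: le_trans (c z zb) _; rewrite ler_wpM2r ?sqr_ge0 ?ler_norm.
Qed.

(** Uniformity in the parameter, later the time, is what survives integration in time; the size of
    the constant is irrelevant since m tends to infinity. *)
Definition negl (e : nat -> I -> R) : Prop :=
  exists M : R, forall m p, `|e m p| <= M * m.+1%:R^-1.

Lemma negl0 : negl (fun _ _ => 0).
Proof. by exists 0 => m p; rewrite mul0r normr0. Qed.

Lemma neglD e e' : negl e -> negl e' -> negl (fun m p => e m p + e' m p).
Proof.
move=> [M H] [M' H']; exists (M + M') => m p; rewrite [leRHS]mulrDl.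
by apply: (le_trans (ler_normD _ _)); exact: lerD.
Qed.

Lemma neglZ c e : negl e -> negl (fun m p => c * e m p).
Proof.
by move=> [M H]; exists (`|c| * M) => m p; rewrite normrM -mulrA ler_wpM2l.
Qed.

Lemma negl_sum (K : Type) (r : seq K) (P : pred K) (e : K -> nat -> I -> R) :
  (forall k, negl (e k)) -> negl (fun m p => \sum_(k <- r | P k) e k m p).
Proof.
move=> H; elim: r => [|k r IH].
  by under eq_fun do under eq_fun do rewrite big_nil; exact: negl0.
under eq_fun do under eq_fun do rewrite big_cons.
by case: (P k) => //; exact: neglD.
Qed.

(** The increments of [g] between nodes telescope to 0 by the boundary values. Each equals h [dg] up
    to M h^2, and there are 2 / h of them. *)
Lemma av_ibp j g dg : dif j g dg ->
  (forall p x, box x -> x 0 j = -1 \/ x 0 j = 1 -> g p x = 0) ->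
  exists2 M : R, 0 <= M & forall m p x, box x ->
    `|av m j (dg p) x| <= M * m.+1%:R^-1.
Proof.
move=> /dif_bound[M M0 H] g0; exists M => // m p x bx; rewrite /av.
set h := m.+1%:R^-1; have h0 : 0 < h := step_gt0 m.
have y k : (k < 2 * m.+1)%N ->
    `|g p (upd x j (node m k.+1)) - g p (upd x j (node m k))
      - h * dg p (upd x j (node m k))| <= M * h ^+ 2.
  move=> km; have [_ _ /(_ (node m k.+1) (node_itv km))] :=
    H p _ (box_node j (ltnW km) bx).
  by rewrite upd_upd upd_coord nodeS (addrC (node m k)) addrK.
have tel : \sum_(k < 2 * m.+1)
    (g p (upd x j (node m k.+1)) - g p (upd x j (node m k))) = 0.
  rewrite -(big_mkord xpredT (fun k => g p (upd x j (node m k.+1)) -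
    g p (upd x j (node m k)))) telescope_sumr // node0 node_last.
  have gl : g p (upd x j (-1)) = 0.
    by apply: g0; [apply: box_upd => //; lra|left; exact: upd_coord].
  have gr : g p (upd x j 1) = 0.
    by apply: g0; [apply: box_upd => //; lra|right; exact: upd_coord].
  by rewrite gl gr subrr.
have {tel} : `|h * \sum_(k < 2 * m.+1) dg p (upd x j (node m k))|
    <= \sum_(k < 2 * m.+1) M * h ^+ 2.
  rewrite -normrN -[X in `|X|]add0r -[X in X - _]tel mulr_sumr -sumrB.
  by apply: (le_trans (ler_norm_sum _ _ _)); apply: ler_sum => k _; exact: y.
rewrite sumr_const card_ord -[M * _ *+ _]mulr_natl natrM.
rewrite (_ : 2 * m.+1%:R * _ = 2 * (M * h)); last first.
  rewrite (_ : m.+1%:R = h^-1); last by rewrite /h invrK.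
  by field; rewrite gt_eqF.
move=> hs; rewrite mulrAC normrM [`|2^-1|]ger0_norm ?invr_ge0 //; lra.
Qed.

Lemma Int_ibp j g dg : dif j g dg ->
  (forall p x, box x -> x 0 j = -1 \/ x 0 j = 1 -> g p x = 0) ->
  negl (fun m p => Int m (dg p)).
Proof.
move=> d g0; have [M M0 H] := av_ibp d g0; exists M => m p.
rewrite /Int (avs_rem _ _ (mem_enum _ j)).
apply: le_trans (avs_norm _ _ _ _) _.
rewrite -(avs_cst m (rem j (enum 'I_n)) (M * _) 0).
by apply: avs_le => [x bx|]; [exact: H|exact: box0].
Qed.

(** Discrete form of the bound of |g| by the integral of |dg| from the face x_j = -1; the factor 2
    is the length of [-1, 1]. The steps up to a node cost 2 M h, and the last partial step to x
    costs another 2 M h. *)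
Lemma av_sobolev j g dg : dif j g dg ->
  (forall p x, box x -> x 0 j = -1 -> g p x = 0) ->
  exists2 M : R, 0 <= M & forall m p x, box x ->
    `|g p x| <= 2 * av m j (fun y => `|dg p y|) x + M * m.+1%:R^-1.
Proof.
move=> /dif_bound[M M0 H] g0; exists (4 * M); first exact: mulr_ge0.
move=> m p x bx; set h := m.+1%:R^-1.
have h0 : 0 < h := step_gt0 m; have h1 : h <= 1 := step_le1 m.
have Mh : 0 <= M * h by rewrite mulr_ge0 // ltW.
have Mh2 : M * h ^+ 2 <= M * h by rewrite ler_wpM2l // expr2 ger_pMr.
have y k : (k < 2 * m.+1)%N -> `|g p (upd x j (node m k.+1))| <=
    `|g p (upd x j (node m k))| + h * `|dg p (upd x j (node m k))| + M * h ^+ 2.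
  move=> km; have [_ _ /(_ (node m k.+1) (node_itv km))] :=
    H p _ (box_node j (ltnW km) bx).
  rewrite upd_upd upd_coord nodeS (addrC (node m k)) addrK.
  set a := g p _; set b := g p _; set c := dg p _ => e.
  rewrite (_ : a = (b + h * c) + (a - b - h * c)); last by ring.
  apply: (le_trans (ler_normD _ _)); rewrite lerD //.
  by apply: (le_trans (ler_normD _ _)); rewrite normrM (ger0_norm (ltW h0)).
pose S k := \sum_(i < k) `|dg p (upd x j (node m i))|.
have yS k : (k <= 2 * m.+1)%N ->
    `|g p (upd x j (node m k))| <= h * S k + k%:R * (M * h ^+ 2).
  elim: k => [|k IH] km.
    rewrite /S big_ord0 mulr0 mul0r addr0 node0 g0 ?normr0 ?upd_coord //.
    by apply: box_upd => //; lra.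
  have := y k km; have := IH (ltnW km).
  by rewrite /S big_ord_recr /= -natr1 mulrDl mul1r mulrDr; lra.
have Smono k : (k <= 2 * m.+1)%N -> S k <= S (2 * m.+1)%N.
  move=> /subnKC <-; rewrite /S big_split_ord /= lerDl.
  by apply: sumr_ge0.
(* The node just to the left of x_j; it is the last node when x_j = 1. *)
have [k km xk] : exists2 k, (k <= 2 * m.+1)%N & node m k <= x 0 j <= node m k + h.
  have z0 : 0 <= (x 0 j + 1) * m.+1%:R by rewrite mulr_ge0 //; have := bx j; lra.
  have /andP[] := truncn_itv z0.
  set k := Num.truncn _ => k1 k2; exists k.
    rewrite -(ler_nat R); apply: le_trans k1 _; rewrite natrM ler_wpM2r //.
    by have := bx j; lra.
  rewrite -nodeS /node; apply/andP; split.
    by rewrite lerBlDr ler_pdivrMr.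
  by rewrite lerBrDr ler_pdivlMr // ltW.
have kb := node_itv km.
have [_ e1 /(_ (x 0 j) (bx j))] := H p _ (box_node j km bx).
rewrite upd_upd upd_id upd_coord => e2.
have := yS k km; have := Smono k km.
have d0 : 0 <= x 0 j - node m k <= h by lra.
move: d0 e2; set d := x 0 j - node m k => /andP[d0 dh] e2 Sk yk.
have dh2 : M * d ^+ 2 <= M * h.
  rewrite ler_wpM2l // expr2; apply: (le_trans _ dh).
  by rewrite ler_piMr //; exact: (le_trans dh h1).
have {e1} e1 : `|d * dg p (upd x j (node m k))| <= M * h.
  by rewrite normrM (ger0_norm d0) mulrC ler_pM.
have kM : k%:R * (M * h ^+ 2) <= 2 * (M * h).
  apply: (@le_trans _ _ ((2 * m.+1)%:R * (M * h ^+ 2))).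
    by rewrite ler_wpM2r ?ler_nat // mulr_ge0 // sqr_ge0.
  rewrite natrM (_ : m.+1%:R = h^-1); last by rewrite /h invrK.
  by rewrite le_eqVlt; apply/orP; left; apply/eqP; field; rewrite gt_eqF.
have Sh : h * S k <= h * S (2 * m.+1)%N by rewrite ler_pM2l.
have -> : 2 * av m j (fun y => `|dg p y|) x = h * S (2 * m.+1)%N.
  by rewrite /av /S -/h; field.
move: e1 e2 yk; set G := g p (upd _ _ _); set D := d * _ => e1 e2 yk.
have : `|g p x| <= `|G| + `|D| + `|g p x - G - D|.
  rewrite {1}(_ : g p x = G + D + (g p x - G - D)); last by ring.
  apply: (le_trans (ler_normD _ _)); rewrite lerD2r; exact: ler_normD.
lra.
Qed.

End Dif.

(** * The cutoff and weighted energies *)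

Section Cutoff.
Context {R : realType} {n : nat}.
Implicit Types (x : 'rV[R]_n) (j k l : 'I_n).

(** Differentiating in x_k removes the k-th factor, so the derivatives of [zeta] involve products
    over smaller index sets. *)
Definition bump (P : pred 'I_n) x : R := \prod_(i | P i) (1 - x 0 i ^+ 2).

Definition zeta : 'rV[R]_n -> R := bump xpredT.

Definition dzeta k x : R := -2 * x 0 k * bump (predC1 k) x.

Definition ddzeta k l x : R :=
  -2 * (k == l)%:R * bump (predC1 k) x +
  -2 * x 0 k * (if l != k then -2 * x 0 l * bump [pred i | (i != k) && (i != l)] x
                else 0).

Lemma bump_itv P x : box x -> 0 <= bump P x <= 1.
Proof.
move=> bx; have y i : 0 <= 1 - x 0 i ^+ 2 <= 1 by have := bx i; nra.
by rewrite prodr_ge0 ?prodr_ile1 // => i _; have /andP[] := y i.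
Qed.

Lemma zeta_itv x : box x -> 0 <= zeta x <= 1.
Proof. exact: bump_itv. Qed.

Lemma zeta0 : zeta 0 = 1.
Proof. by rewrite /zeta /bump big1 // => i _; rewrite mxE expr0n subr0. Qed.

Lemma zeta_face x j : x 0 j = -1 \/ x 0 j = 1 -> zeta x = 0.
Proof.
by rewrite /zeta /bump (bigD1 j) //= => -[] ->; rewrite ?sqrrN expr1n subrr mul0r.
Qed.

Lemma dzeta_le k x : box x -> `|dzeta k x| <= 2.
Proof.
move=> bx; have /andP[b0 b1] := bump_itv (predC1 k) bx.
rewrite /dzeta ler_norml; have := bx k.
set y := x 0 k; set b := bump _ x in b0 b1 *; nra.
Qed.

Lemma ddzeta_le k l x : box x -> `|ddzeta k l x| <= 6.
Proof.
move=> bx; have /andP[b0 b1] := bump_itv (predC1 k) bx.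
apply: (le_trans (ler_normD _ _)).
have yk : `|x 0 k| <= 1 by rewrite ler_norml bx.
have yl : `|x 0 l| <= 1 by rewrite ler_norml bx.
have e1 : `|-2 * (k == l)%:R * bump (predC1 k) x| <= 2.
  rewrite !normrM normrN !normr_nat (ger0_norm b0).
  by case: (k == l) => /=; lra.
have e2 : `|-2 * x 0 k * (if l != k then -2 * x 0 l *
    bump [pred i | (i != k) && (i != l)] x else 0)| <= 4.
  case: ifP => _; last by rewrite mulr0 normr0.
  set P := [pred i | _]; have /andP[c0 c1] := bump_itv P bx.
  rewrite !normrM normrN normr_nat (ger0_norm c0).
  have := normr_ge0 (x 0 k); have := normr_ge0 (x 0 l) => ? ?.
  have kl : 0 <= `|x 0 k| * `|x 0 l| <= 1 by rewrite mulr_ge0 //= mulr_ile1.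
  rewrite (_ : _ * _ = 4 * (`|x 0 k| * `|x 0 l| * bump P x)); last by ring.
  have : `|x 0 k| * `|x 0 l| * bump P x <= 1.
    by case/andP: kl => kl0 kl1; rewrite mulr_ile1.
  lra.
lra.
Qed.

Context {I : Type}.

Lemma dif_indep j (g : 'rV[R]_n -> R) (M : R) :
  (forall x z, g (upd x j z) = g x) -> (forall x, box x -> `|g x| <= M) ->
  dif j (fun _ : I => g) (fun _ _ => 0).
Proof.
move=> gi gM; exists M => p x bx; have M0 : 0 <= M by apply: le_trans (gM x bx).
split=> [||z _]; [exact: gM|by rewrite normr0|].
by rewrite gi subrr mulr0 subr0 normr0 mulr_ge0 // sqr_ge0.
Qed.

(** If [l] is in [P], split off the factor 1 - x_l^2; the remaining product does not depend on
    x_l. *)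
Lemma dif_bump P l : dif l (fun _ : I => bump P)
  (fun _ x => if P l then -2 * x 0 l * bump [pred i | P i && (i != l)] x else 0).
Proof.
have indep Q : ~~ Q l -> dif l (fun _ : I => bump Q) (fun _ _ => 0).
  move=> Ql; apply: (@dif_indep _ _ 1) => [x z|x bx].
    apply: eq_bigr => i Qi; rewrite upd_other //.
    by apply: contraNneq Ql => <-.
  by have /andP[b0 b1] := bump_itv Q bx; rewrite ger0_norm.
case Pl: (P l); last by apply: indep; rewrite Pl.
have d1 : dif l (fun (_ : I) (x : 'rV[R]_n) => 1 + -1 * x 0 l ^+ 2)
    (fun _ x => 0 + -1 * (2%:R * x 0 l ^+ 1 * (l == l)%:R)).
  by apply: difD; [exact: dif_cst|apply/difZ/difX/dif_coord].
apply: dif_ext (difM d1 (indep [pred i | P i && (i != l)] _)) => [p x|p x|].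
- by rewrite /bump [RHS](bigD1 l) //= mulN1r.
- by rewrite eqxx mulr0 addr0 expr1 /=; ring.
- by rewrite /= eqxx andbF.
Qed.

Lemma dif_zeta k : dif k (fun _ : I => zeta) (fun _ => dzeta k).
Proof. by apply: dif_ext (dif_bump xpredT k). Qed.

Lemma dif_dzeta k l : dif l (fun _ : I => dzeta k) (fun _ => ddzeta k l).
Proof.
have := difM (difZ (-2) (@dif_coord R n I l k)) (dif_bump (predC1 k) l).
by apply: dif_ext.
Qed.

End Cutoff.

Section Energy.
Context {R : realType} {n : nat} {I : Type}.
Implicit Types (f : seq 'I_n -> I -> 'rV[R]_n -> R) (J : seq 'I_n) (k l : 'I_n).

(** Abstract family of partial derivatives: [f J] stands for the derivative of a function along the
    word [J]. The parameter in [I] will be the time, so that every expansion is uniform in time. *)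
Definition tower f : Prop :=
  (forall J j, dif j (f J) (f (j :: J))) /\
  (forall J k l p x, f (k :: l :: J) p x = f (l :: k :: J) p x).

Definition gsq f (i : nat) (p : I) (x : 'rV[R]_n) : R :=
  \sum_(J : i.-tuple 'I_n) f J p x ^+ 2.

Definition bih f J (p : I) (x : 'rV[R]_n) : R :=
  - \sum_k \sum_l f [:: k, k, l, l & J] p x.

(* The exponent 2i matches the scaling of |nabla^i u|^2, so that the same
   quantities bound every error term of the energy and interpolation estimates. *)
Definition wH f (i m : nat) (p : I) : R :=
  Int m (fun x => zeta x ^+ (2 * i) * gsq f i p x).

(** The exponent is 2 (i + 2), so that the dissipation of this energy is exactly [wH] at level i +
    2. *)
Definition wE f (i m : nat) (p : I) : R :=
  Int m (fun x => zeta x ^+ (2 * i).+4 * gsq f i p x).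

(** The time derivative of [wE] when each [f J] evolves by [bih f J]. *)
Definition wdE f (i m : nat) (p : I) : R :=
  Int m (fun x => zeta x ^+ (2 * i).+4 *
                  \sum_(J : i.-tuple 'I_n) 2 * f J p x * bih f J p x).

Lemma sum_tupleS i (F : seq 'I_n -> R) :
  \sum_(J : i.+1.-tuple 'I_n) F J = \sum_(J : i.-tuple 'I_n) \sum_k F (k :: J).
Proof.
rewrite exchange_big pair_big /=.
rewrite (reindex (fun q : 'I_n * i.-tuple 'I_n => [tuple of q.1 :: q.2])) //=.
exists (fun J : i.+1.-tuple 'I_n => (thead J, [tuple of behead J])) => [[k J] _|J _].
  by congr pair; apply/val_inj.
by rewrite -tuple_eta.
Qed.

Definition null (G : I -> 'rV[R]_n -> R) : Prop := negl (fun m p => Int m (G p)).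

Lemma nullD G G' : null G -> null G' -> null (fun p x => G p x + G' p x).
Proof.
by move=> h h'; rewrite /null; under eq_fun do under eq_fun do rewrite IntD; exact: neglD.
Qed.

Lemma nullZ c G : null G -> null (fun p x => c * G p x).
Proof.
by move=> h; rewrite /null; under eq_fun do under eq_fun do rewrite IntZ; exact: neglZ.
Qed.

Lemma null_sum (K : Type) (r : seq K) (P : pred K) (G : K -> I -> 'rV[R]_n -> R) :
  (forall a, null (G a)) -> null (fun p x => \sum_(k <- r | P k) G k p x).
Proof.
by move=> h; rewrite /null; under eq_fun do under eq_fun do rewrite Int_sum; exact: negl_sum.
Qed.

(** The integrand is the j-th derivative of zeta^(q+1) g, which vanishes on the faces of the
    cube. *)
Lemma null_zetaM q j g dg : dif j g dg ->
  null (fun p x => q.+1%:R * zeta x ^+ q * dzeta j x * g p x + zeta x ^+ q.+1 * dg p x).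
Proof.
move=> dg_; apply: (Int_ibp (difM (difX q.+1 (dif_zeta j)) dg_)) => p x _ fx.
by rewrite (zeta_face fx) expr0n mul0r.
Qed.

(** Here a, b, c, d, e3, e4 stand for v, v_k, v_l, v_kl, v_kll, v_kkll. The flux cancels all terms
    with e3 and e4 and leaves -2 Z^p d^2; half of it is kept as dissipation and the other half
    absorbs the products of d with a, b, c. *)
Lemma pointwise_energy (p i : nat) (Z zk zl zkl a b c d e3 e4 : R) :
  0 <= Z <= 1 -> `|zk| <= 2 -> `|zl| <= 2 -> `|zkl| <= 6 -> p = (2 * i).+4 ->
  - 2 * (Z ^+ p * (a * e4)) <=
    - (Z ^+ p * d ^+ 2) + 108 * p%:R ^+ 4 *
      (Z ^+ (2 * i) * a ^+ 2 + Z ^+ (2 * i).+2 * (b ^+ 2 + c ^+ 2)) +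
    -2 * ((p%:R * Z ^+ p.-1 * zk * (a * e3) + Z ^+ p * (b * e3 + a * e4)) +
      (- p%:R * (p.-1%:R * Z ^+ p.-2 * zl * (zk * (a * d)) +
         Z ^+ p.-1 * (zkl * (a * d) + zk * (c * d + a * e3)))
      + - 1 * (p%:R * Z ^+ p.-1 * zl * (b * d) + Z ^+ p * (d * d + b * e3)))).
Proof.
move=> /andP[Z0 Z1] hk hl hkl pE.
have P1 : 4 <= p%:R :> R by rewrite pE ler_nat.
have -> : p.-1%:R = p%:R - 1 :> R by rewrite pE /= -[_.+4%:R]natr1 addrK.
have {pE} [-> -> ->] : [/\ Z ^+ p = (Z ^+ i * Z ^+ 2) ^+ 2,
    Z ^+ p.-1 = Z ^+ i ^+ 2 * Z ^+ 3 & Z ^+ p.-2 = (Z ^+ i * Z) ^+ 2].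
  by rewrite pE /= !exprS mul2n -addnn exprD; split; ring.
have [-> ->] : Z ^+ (2 * i) = Z ^+ i ^+ 2 /\ Z ^+ (2 * i).+2 = (Z ^+ i * Z) ^+ 2.
  by rewrite !exprS mul2n -addnn exprD; split; ring.
set w := Z ^+ i; set P := p%:R in P1 *.
pose X := w * Z ^+ 2 * d; pose V := w * a; pose Yb := w * Z * b; pose Yc := w * Z * c.
pose c1 := P * (P - 1) * (zl * zk) + P * (Z * zkl).
have key : - X ^+ 2 - 2 * (c1 * (X * V)) - 2 * (P * zk * (X * Yc)) - 2 * (P * zl * (X * Yb))
    <= 108 * P ^+ 4 * (V ^+ 2 + (Yb ^+ 2 + Yc ^+ 2)).
  (* There are three mixed terms, so each may use a third of X^2. The coefficient of X V is at most
     6 P^2, and 3 (6 P^2)^2 = 108 P^4 gives the constant. *)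
  have young (u C v : R) : 0 <= C -> `|u| <= C ->
      - 2 * (u * (X * v)) <= X ^+ 2 / 3 + 3 * C ^+ 2 * v ^+ 2.
    move=> C0 uC; have u2 : u ^+ 2 <= C ^+ 2 by rewrite -real_normK ?num_real // ler_pXn2r ?nnegrE.
    have := sqr_ge0 (X + 3 * u * v).
    have := ler_wpM2r (sqr_ge0 v) u2; nra.
  have n1 : `|c1| <= 6 * P ^+ 2.
    apply: (le_trans (ler_normD _ _)); rewrite !normrM.
    rewrite [`|P|]ger0_norm ?[`|P - 1|]ger0_norm ?[`|Z|]ger0_norm; [|lra..].
    have h1 : `|zl| * `|zk| <= 2 * 2 by apply: ler_pM.
    have h2 : Z * `|zkl| <= 1 * 6 by apply: ler_pM.
    have h3 : P * (P - 1) * (`|zl| * `|zk|) <= P * (P - 1) * (2 * 2).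
      by apply: ler_wpM2l => //; rewrite mulr_ge0 //; lra.
    have h4 : P * (Z * `|zkl|) <= P * (1 * 6) by apply: ler_wpM2l => //; lra.
    nra.
  have n2 : `|P * zk| <= 2 * P.
    rewrite normrM ger0_norm; last by lra.
    by rewrite mulrC ler_wpM2r //; lra.
  have n3 : `|P * zl| <= 2 * P.
    rewrite normrM ger0_norm; last by lra.
    by rewrite mulrC ler_wpM2r //; lra.
  have P2 : 0 <= 6 * P ^+ 2 by rewrite mulr_ge0 // sqr_ge0.
  have P3 : 0 <= 2 * P by lra.
  have y1 := young c1 _ V P2 n1.
  have y2 := young _ _ Yc P3 n2.
  have y3 := young _ _ Yb P3 n3.
  have P4 : 12 * P ^+ 2 <= 108 * P ^+ 4.
    have : 1 <= P ^+ 2 by nra.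
    rewrite (_ : P ^+ 4 = (P ^+ 2) ^+ 2); [nra|by ring].
  have := ler_wpM2r (sqr_ge0 Yb) P4; have := ler_wpM2r (sqr_ge0 Yc) P4.
  rewrite (_ : 3 * (6 * P ^+ 2) ^+ 2 = 108 * P ^+ 4) in y1; last by ring.
  rewrite (_ : 3 * (2 * P) ^+ 2 = 12 * P ^+ 2) in y2 y3; last by ring.
  lra.
by move: key; rewrite /X /V /Yb /Yc /c1; lra.
Qed.

End Energy.

(** * The differential inequality for one energy *)

Section EnergyInequality.
Context {R : realType} {n : nat} {I : Type}.
Implicit Types (f : seq 'I_n -> I -> 'rV[R]_n -> R) (J : seq 'I_n) (k l : 'I_n).

Lemma gsq_ge0 f i p x : 0 <= gsq f i p x.
Proof. by apply: sumr_ge0 => J _; exact: sqr_ge0. Qed.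

Lemma wH_ge0 f i m p : 0 <= wH f i m p.
Proof.
apply: Int_ge0 => x bx; rewrite mulr_ge0 ?gsq_ge0 // exprn_ge0 //.
by have /andP[] := zeta_itv bx.
Qed.

Lemma gsqS f i p x :
  gsq f i.+1 p x = \sum_(J : i.-tuple 'I_n) \sum_k f (k :: J) p x ^+ 2.
Proof. exact: (sum_tupleS i (fun J => f J p x ^+ 2)). Qed.

Lemma gsqSS f i p x :
  gsq f i.+2 p x = \sum_(J : i.-tuple 'I_n) \sum_l \sum_k f [:: k, l & J] p x ^+ 2.
Proof. by rewrite gsqS (sum_tupleS i (fun J => \sum_k f (k :: J) p x ^+ 2)). Qed.

Lemma sum_pairs (c : R) (B : 'I_n -> R) :
  \sum_k \sum_l (c + (B k + B l)) = n%:R ^+ 2 * c + 2 * n%:R * \sum_k B k.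
Proof.
under eq_bigr => k _ do
  rewrite !big_split /= !sumr_const card_ord -(mulr_natl c) -(mulr_natl (B k)).
rewrite !big_split /= !sumr_const card_ord -mulr_sumr.
by rewrite -(mulr_natl (_ * c)) -(mulr_natl (\sum_k B k)); ring.
Qed.

(* With v = f J, phi = zeta^q and all sums over J, k, l, this is -2 times
   d_k (phi v v_kll) - d_l (phi_k v v_kl) - d_l (phi v_k v_kl). *)
Definition energy_flux f i (p : I) (x : 'rV[R]_n) : R :=
  let q := (2 * i).+4 in let Z := zeta x in
  \sum_(J : i.-tuple 'I_n) \sum_k \sum_l
    -2 * ((q%:R * Z ^+ q.-1 * dzeta k x * (f J p x * f [:: k, l, l & J] p x) +
           Z ^+ q * (f (k :: J) p x * f [:: k, l, l & J] p x +
                     f J p x * f [:: k, k, l, l & J] p x)) +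
      (- q%:R * (q.-1%:R * Z ^+ q.-2 * dzeta l x *
                  (dzeta k x * (f J p x * f [:: k, l & J] p x)) +
         Z ^+ q.-1 * (ddzeta k l x * (f J p x * f [:: k, l & J] p x) +
           dzeta k x * (f (l :: J) p x * f [:: k, l & J] p x +
                        f J p x * f [:: k, l, l & J] p x))) +
       - 1 * (q%:R * Z ^+ q.-1 * dzeta l x * (f (k :: J) p x * f [:: k, l & J] p x) +
         Z ^+ q * (f [:: k, l & J] p x * f [:: k, l & J] p x +
                   f (k :: J) p x * f [:: k, l, l & J] p x)))).

Lemma null_energy_flux f i : tower f -> null (energy_flux f i).
Proof.
move=> [hf sw]; rewrite /energy_flux /=.
have {}sw J k l : f [:: k, l & J] = f [:: l, k & J].
  by apply/funext => p; apply/funext => x; exact: sw.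
apply: null_sum => J; apply: null_sum => k; apply: null_sum => l.
apply/nullZ/nullD; first exact: null_zetaM (difM (hf J k) (hf [:: k, l, l & J] k)).
have d1 := hf J l; have d2 := hf [:: k, l & J] l; have d3 := hf (k :: J) l.
rewrite sw in d3; rewrite (sw (l :: J)) in d2.
apply/nullD; apply/nullZ; last exact: null_zetaM (difM d3 d2).
exact: null_zetaM (difM (dif_dzeta k l) (difM d1 d2)).
Qed.

Definition energy_cst (i : nat) : R :=
  108 * (2 * i).+4%:R ^+ 4 * (n%:R ^+ 2 + 2 * n%:R).

(** Integrating by parts amounts to adding [energy_flux], whose grid average is O(1 / m). What
    remains is an inequality between integrands, checked separately for each J, k, l. *)
Lemma wdE_le f i : tower f -> exists2 e : nat -> I -> R, negl e & forall m p,
  wdE f i m p <=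
    - wH f i.+2 m p + energy_cst i * (wH f i.+1 m p + wH f i m p) + e m p.
Proof.
move=> tf; exists (fun m p => Int m (energy_flux f i p)); first exact: null_energy_flux.
move=> m p; pose K : R := 108 * (2 * i).+4%:R ^+ 4.
have K0 : 0 <= K by rewrite mulr_ge0 // exprn_ge0.
have pw x : box x -> zeta x ^+ (2 * i).+4 *
      (\sum_(J : i.-tuple 'I_n) 2 * f J p x * bih f J p x) <=
    -1 * (zeta x ^+ (2 * i.+2) * gsq f i.+2 p x) +
    (K * (n%:R ^+ 2) * (zeta x ^+ (2 * i) * gsq f i p x) +
     K * (2 * n%:R) * (zeta x ^+ (2 * i.+1) * gsq f i.+1 p x)) +
    energy_flux f i p x.
  move=> bx; set Z := zeta x.
  have -> : Z ^+ (2 * i).+4 * (\sum_(J : i.-tuple 'I_n) 2 * f J p x * bih f J p x) =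
     \sum_(J : i.-tuple 'I_n) \sum_k \sum_l
       - 2 * (Z ^+ (2 * i).+4 * (f J p x * f [:: k, k, l, l & J] p x)).
    rewrite mulr_sumr; apply: eq_bigr => J _.
    rewrite /bih mulrN mulrN -mulNr mulr_sumr mulr_sumr; apply: eq_bigr => k _.
    by rewrite mulr_sumr mulr_sumr; apply: eq_bigr => l _; ring.
  have Zb := zeta_itv bx.
  pose T (J : i.-tuple 'I_n) k l : R :=
    - (Z ^+ (2 * i).+4 * f [:: k, l & J] p x ^+ 2) +
    K * (Z ^+ (2 * i) * f J p x ^+ 2 +
         Z ^+ (2 * i).+2 * (f (k :: J) p x ^+ 2 + f (l :: J) p x ^+ 2)).
  have -> : -1 * (Z ^+ (2 * i.+2) * gsq f i.+2 p x) +
    (K * (n%:R ^+ 2) * (Z ^+ (2 * i) * gsq f i p x) +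
     K * (2 * n%:R) * (Z ^+ (2 * i.+1) * gsq f i.+1 p x)) =
    \sum_(J : i.-tuple 'I_n) \sum_k \sum_l T J k l.
    rewrite gsqSS gsqS /gsq !mulnS !addSn !add0n !mulr_sumr -!big_split /=.
    apply: eq_bigr => J _.
    pose B k := K * (Z ^+ (2 * i).+2 * f (k :: J) p x ^+ 2).
    have -> : \sum_k \sum_l T J k l =
        \sum_k \sum_l (- (Z ^+ (2 * i).+4 * f [:: k, l & J] p x ^+ 2)) +
        \sum_k \sum_l (K * (Z ^+ (2 * i) * f J p x ^+ 2) + (B k + B l)).
      rewrite -big_split; apply: eq_bigr => k _ /=.
      by rewrite -big_split; apply: eq_bigr => l _ /=; rewrite /T /B; ring.
    rewrite sum_pairs [in RHS]exchange_big /=; congr (_ + (_ + _)).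
    - rewrite !mulr_sumr; apply: eq_bigr => l _.
      by rewrite !mulr_sumr; apply: eq_bigr => k _; rewrite mulN1r.
    - by ring.
    - by rewrite /B -!mulr_sumr; ring.
  rewrite /energy_flux -big_split; apply: ler_sum => J _.
  rewrite -big_split; apply: ler_sum => k _.
  rewrite -big_split; apply: ler_sum => l _.
  by rewrite /T; apply: pointwise_energy => //; rewrite ?dzeta_le ?ddzeta_le.
apply: le_trans (Int_le m pw) _.
rewrite !IntD !IntZ -!/(wH f _ m p) lerD2r mulN1r lerD2l.
have h1 := wH_ge0 f i m p; have h2 := wH_ge0 f i.+1 m p.
have n0 : 0 <= n%:R :> R := ler0n _ n.
rewrite /energy_cst -/K -subr_ge0.
rewrite [X in 0 <= X](_ : _ =
  K * (n%:R ^+ 2 * wH f i.+1 m p + 2 * n%:R * wH f i m p)); last by ring.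
by rewrite mulr_ge0 // addr_ge0 // mulr_ge0 // ?sqr_ge0 // mulr_ge0.
Qed.

End EnergyInequality.

(** * Interpolation between consecutive orders *)

Section Interp.
Context {R : realType} {n : nat} {I : Type}.
Implicit Types (f : seq 'I_n -> I -> 'rV[R]_n -> R).

(* Twice the sum over J and l of d_l (zeta^(2i+2) v v_l), with v = f J. *)
Definition interp_flux f i (p : I) (x : 'rV[R]_n) : R :=
  let Z := zeta x in
  \sum_(J : i.-tuple 'I_n) \sum_l
    2 * ((2 * i).+2%:R * Z ^+ (2 * i).+1 * dzeta l x * (f J p x * f (l :: J) p x) +
         Z ^+ (2 * i).+2 * (f (l :: J) p x * f (l :: J) p x +
                            f J p x * f [:: l, l & J] p x)).

Lemma null_interp_flux f i : tower f -> null (interp_flux f i).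
Proof.
move=> [hf sw]; rewrite /interp_flux /=.
apply: null_sum => J; apply: null_sum => l.
exact/nullZ/(null_zetaM _ (difM (hf J l) (hf (l :: J) l))).
Qed.

Definition interp_cst (i : nat) (d : R) : R := n%:R * (4 * (2 * i).+2%:R ^+ 2 + d^-1).

Lemma interp_cst_ge0 i d : 0 < d -> 0 <= interp_cst i d.
Proof. by move=> d0; rewrite mulr_ge0 // addr_ge0 ?invr_ge0 ?mulr_ge0 ?sqr_ge0 // ltW. Qed.

(** Integrate zeta^(2i+2) |v_l|^2 by parts once. The flux is taken twice so that, with one Y^2 kept
    on the left, a second one is available to absorb the term in which the derivative falls on the
    cutoff. *)
Lemma wH_interp f i d : tower f -> 0 < d ->
  exists2 e : nat -> I -> R, negl e & forall m p,
  wH f i.+1 m p <= d * wH f i.+2 m p + interp_cst i d * wH f i m p + e m p.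
Proof.
move=> tf d0; exists (fun m p => Int m (interp_flux f i p)); first exact: null_interp_flux.
move=> m p; rewrite -!IntZ -!IntD; apply: Int_le => x bx.
set Z := zeta x; pose Q : R := (2 * i).+2%:R.
pose L := 4 * Q ^+ 2 + d^-1.
have -> : Z ^+ (2 * i.+1) * gsq f i.+1 p x =
    \sum_(J : i.-tuple 'I_n) \sum_l Z ^+ (2 * i).+2 * f (l :: J) p x ^+ 2.
  rewrite gsqS mulnS mulr_sumr; apply: eq_bigr => J _.
  by rewrite mulr_sumr; apply: eq_bigr.
have step1 : \sum_(J : i.-tuple 'I_n) \sum_l
    (d * (Z ^+ (2 * i).+4 * f [:: l, l & J] p x ^+ 2) +
     L * (Z ^+ (2 * i) * f J p x ^+ 2)) <=
    d * (Z ^+ (2 * i.+2) * gsq f i.+2 p x) +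
    interp_cst i d * (Z ^+ (2 * i) * gsq f i p x).
  rewrite gsqSS !mulnS !addSn !add0n /gsq !mulr_sumr -big_split /=.
  apply: ler_sum => J _; rewrite big_split /= lerD //.
    rewrite !mulr_sumr; apply: ler_sum => l _; rewrite ler_pM2l //.
    rewrite ler_wpM2l ?exprn_ge0 //; first by have /andP[] := zeta_itv bx.
    (* Only the pure derivatives v_ll occur; they are part of the full tensor of order i + 2. *)
    by rewrite (bigD1 l) //= lerDl; apply: sumr_ge0 => *; exact: sqr_ge0.
  by rewrite sumr_const card_ord /interp_cst -(mulr_natl (_ * (_ * _))) mulrA.
apply: le_trans (lerD step1 (lexx _)).
rewrite /interp_flux -big_split; apply: ler_sum => J _.
rewrite -big_split; apply: ler_sum => l _ /=; rewrite -/Z -/Q.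
have Zb : `|dzeta l x| <= 2 := dzeta_le l bx.
move: Zb; set zl := dzeta l x; set a := f J p x; set c := f (l :: J) p x.
set D := f _ p x => zl2; set w := Z ^+ i.
have [-> -> -> ->] : [/\ Z ^+ (2 * i).+4 = (w * Z ^+ 2) ^+ 2,
    Z ^+ (2 * i).+1 = w ^+ 2 * Z, Z ^+ (2 * i).+2 = (w * Z) ^+ 2
    & Z ^+ (2 * i) = w ^+ 2].
  by rewrite /w !exprS mul2n -addnn exprD; split; ring.
pose X := w * Z ^+ 2 * D; pose V := w * a; pose Y := w * Z * c.
suff key : Y ^+ 2 <= d * X ^+ 2 + L * V ^+ 2 + 2 * (Q * zl * (V * Y) + Y ^+ 2 + X * V).
  by move: key; rewrite /X /V /Y; lra.
have z4 : zl ^+ 2 <= 4 by rewrite -real_normK ?num_real //; have := normr_ge0 zl; nra.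
have e1 : - (2 * (Q * zl * (V * Y))) <= Y ^+ 2 + 4 * Q ^+ 2 * V ^+ 2.
  have := sqr_ge0 (Y + Q * zl * V).
  have := ler_wpM2r (sqr_ge0 (Q * V)) z4; rewrite /=; lra.
have e2 : - (2 * (X * V)) <= d * X ^+ 2 + d^-1 * V ^+ 2.
  rewrite -subr_ge0 [X in 0 <= X](_ : _ = d^-1 * (d * X + V) ^+ 2).
    by rewrite mulr_ge0 ?sqr_ge0 // invr_ge0 ltW.
  by field; rewrite gt_eqF.
rewrite /L; lra.
Qed.

End Interp.

(** Induction on the top order. Both of the highest levels are kept on the dissipative side because
    the next energy has bad terms at exactly these two. *)
Lemma lyapunov {R : realType} (n M : nat) :
  exists A : nat -> R, exists c K : R,
  [/\ forall i, 0 < A i, 0 < c, 0 <= K &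
  forall (I : Type) (f : seq 'I_n -> I -> 'rV[R]_n -> R), tower f ->
  exists2 e : nat -> I -> R, negl e & forall m p,
  \sum_(1 <= i < M.+2) A i * wdE f i m p <=
    - c * (wH f M.+3 m p + wH f M.+2 m p) + K * wH f 1 m p + e m p].
Proof.
have cst0 i : 0 <= @energy_cst R n i.
  by rewrite !mulr_ge0 // ?exprn_ge0 // addr_ge0 // ?mulr_ge0 // exprn_ge0.
elim: M => [|M [A [c [K [A0 c0 K0 IH]]]]].
  pose C := @energy_cst R n 1; have C0 : 0 <= C := cst0 1%N.
  (* Adding C + 1/2 times the interpolation inequality turns C H_2 into -H_2 / 2 and uses up half of
     the dissipation H_3. *)
  pose d := 2^-1 / (C + 2^-1); have d0 : 0 < d by rewrite divr_gt0 //; lra.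
  pose B := @interp_cst R n 1 d; have B0 : 0 <= B := interp_cst_ge0 1 d0.
  exists (fun _ => 1), 2^-1, (C + (C + 2^-1) * B).
  split=> [//|//||I f tf]; first by rewrite addr_ge0 // mulr_ge0 //; lra.
  have [e ne eE] := wdE_le 1 tf; have [e' ne' eI] := wH_interp 1 tf d0.
  exists (fun m p => e m p + (C + 2^-1) * e' m p); first exact/neglD/neglZ.
  move=> m p; rewrite big_nat1 mul1r; have := eE m p; rewrite -/C.
  have := eI m p; rewrite -/B -(ler_pM2l (_ : 0 < C + 2^-1)); last by lra.
  have -> : (C + 2^-1) * (d * wH f 3 m p + B * wH f 1 m p + e' m p) =
      2^-1 * wH f 3 m p + (C + 2^-1) * B * wH f 1 m p + (C + 2^-1) * e' m p.
    by rewrite /d; field; lra.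
  lra.
pose C := @energy_cst R n M.+2; have C0 : 0 <= C := cst0 M.+2.
(* Small enough that the bad terms of the new energy cost at most half of the dissipation obtained
   so far. *)
pose al := c / (2 * (C + 1)); have al0 : 0 < al by rewrite divr_gt0 // mulr_gt0 //; lra.
have alC : al * C <= c / 2.
  rewrite /al (_ : c / (2 * (C + 1)) * C = c / 2 * (C / (C + 1))); last by field; lra.
  by rewrite ler_piMr ?divr_ge0 // ?ltW // ltr_pdivrMr; lra.
exists (fun i => if i == M.+2 then al else A i), (Num.min al (c / 2)), K.
split=> [i||//|I f tf]; first by case: ifP.
  by rewrite lt_min al0 divr_gt0.
have [e ne eE] := wdE_le M.+2 tf; have [e' ne' eI] := IH I f tf.
exists (fun m p => e' m p + al * e m p); first exact/neglD/neglZ.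
move=> m p; rewrite big_nat_recr //= eqxx.
under eq_big_nat => i /andP[_ iM] do rewrite (ltn_eqF iM).
have := eI m p; have := eE m p; rewrite -/C.
have h3 := wH_ge0 f M.+3 m p; have h2 := wH_ge0 f M.+2 m p.
have h4 := wH_ge0 f M.+4 m p => H1 H2.
have {}H1 := ler_wpM2l (ltW al0) H1.
have s0 : 0 <= wH f M.+3 m p + wH f M.+2 m p by rewrite addr_ge0.
have := ler_wpM2r s0 alC.
have m1 : Num.min al (c / 2) <= al by rewrite ge_min lexx.
have m2 : Num.min al (c / 2) <= c / 2 by rewrite ge_min lexx orbT.
have := ler_wpM2r h4 m1; have := ler_wpM2r h3 m2.
have : 0 <= c / 2 * wH f M.+2 m p by rewrite mulr_ge0 // divr_ge0 // ltW.
move: (Num.min _ _) (wH f M.+4 m p) (wH f M.+3 m p) (wH f M.+2 m p) (wH f 1 m p) H1 H2 => *.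
lra.
Qed.

(** * Sobolev inequality *)

Section Sobolev.
Context {R : realType} {n : nat} {I : Type}.
Implicit Types (f : seq 'I_n -> I -> 'rV[R]_n -> R) (G D : I -> 'rV[R]_n -> R).

Definition asum f (r : nat) (p : I) (x : 'rV[R]_n) : R :=
  \sum_(i < r) \sum_(J : i.+1.-tuple 'I_n) `|f J p x|.

Definition av_dom (j : 'I_n) G D : Prop := exists2 M : R, 0 <= M &
  forall m p x, box x -> G p x <= 2 * av m j (D p) x + M * m.+1%:R^-1.

Lemma av_dom_sum j (K : Type) (r : seq K) (G D : K -> I -> 'rV[R]_n -> R) :
  (forall k, av_dom j (G k) (D k)) ->
  av_dom j (fun p x => \sum_(k <- r) G k p x) (fun p x => \sum_(k <- r) D k p x).
Proof.
move=> H; elim: r => [|k r [M M0 IH]].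
  exists 0 => // m p x bx; rewrite big_nil mul0r addr0.
  rewrite (_ : (fun x => \sum_(k <- [::]) D k p x) = fun=> 0) ?av_cst ?mulr0 //.
  by apply/funext => y; rewrite big_nil.
have [M' M'0 H'] := H k; exists (M' + M); first exact: addr_ge0.
move=> m p x bx; rewrite big_cons.
rewrite (_ : (fun y => _) = fun y => D k p y + \sum_(l <- r) D l p y); last first.
  by apply/funext => y; rewrite big_cons.
rewrite avD /= mulrDr [(M' + M) * _]mulrDl addrACA; apply: lerD; [exact: H'|exact: IH].
Qed.

Lemma asum_le f r p x : asum f r p x <= asum f r.+1 p x.
Proof. by rewrite /asum [leRHS]big_ord_recr /= lerDl; apply: sumr_ge0. Qed.

Lemma asum_shift f r j p x :
  \sum_(i < r) \sum_(J : i.+1.-tuple 'I_n) `|f (j :: J) p x| <= asum f r.+1 p x.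
Proof.
rewrite /asum [leRHS]big_ord_recl ler_wpDl //; first exact: sumr_ge0.
apply: ler_sum => i _; rewrite (sum_tupleS _ (fun J => `|f J p x|)).
by apply: ler_sum => J _; rewrite (bigD1 j) //= lerDl; apply: sumr_ge0.
Qed.

(** One coordinate costs one derivative and one power of [zeta]. The term 2 (a + 1) comes from
    differentiating the cutoff, the term 1 from differentiating [f]. *)
Lemma asum_av f r a j : tower f ->
  av_dom j (fun p x => zeta x ^+ a.+1 * asum f r p x)
    (fun p x => (2 * a.+1%:R + 1) * (zeta x ^+ a * asum f r.+1 p x)).
Proof.
move=> [hf _].
pose g (J : seq 'I_n) p x := zeta x ^+ a.+1 * f J p x.
pose dg (J : seq 'I_n) p x :=
  a.+1%:R * zeta x ^+ a * dzeta j x * f J p x + zeta x ^+ a.+1 * f (j :: J) p x.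
have : av_dom j
    (fun p x => \sum_(i < r) \sum_(J : i.+1.-tuple 'I_n) `|g J p x|)
    (fun p x => \sum_(i < r) \sum_(J : i.+1.-tuple 'I_n) `|dg J p x|).
  apply: av_dom_sum => i; apply: av_dom_sum => J.
  apply: (av_sobolev (difM (difX a.+1 (dif_zeta j)) (hf J j))) => p x _ fx.
  by rewrite (zeta_face (or_introl fx)) expr0n mul0r.
move=> [M M0 H]; exists M => // m p x bx; have := H m p x bx.
have /andP[z0 z1] := zeta_itv bx.
have -> : \sum_(i < r) \sum_(J : i.+1.-tuple 'I_n) `|g J p x| =
    zeta x ^+ a.+1 * asum f r p x.
  rewrite /asum mulr_sumr; apply: eq_bigr => i _; rewrite mulr_sumr.
  by apply: eq_bigr => J _; rewrite normrM ger0_norm // exprn_ge0.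
move=> h; apply: le_trans h _; rewrite lerD2r ler_pM2l //.
apply: av_le => // y {z0 z1} /[dup] byx /zeta_itv/andP[z0 z1].
have za : 0 <= zeta y ^+ a by rewrite exprn_ge0.
have a0 : 0 <= a.+1%:R :> R by exact: ler0n.
apply: (@le_trans _ _ (\sum_(i < r) \sum_(J : i.+1.-tuple 'I_n)
    zeta y ^+ a * (2 * a.+1%:R * `|f J p y| + `|f (j :: J) p y|))).
  apply: ler_sum => i _; apply: ler_sum => J _.
  apply: (le_trans (ler_normD _ _)); rewrite mulrDr; apply: lerD.
    rewrite 3!normrM normrX normr_nat (ger0_norm z0).
    rewrite [leRHS](_ : _ = a.+1%:R * zeta y ^+ a * 2 * `|f J p y|); last by ring.
    by rewrite ler_wpM2r // ler_wpM2l ?mulr_ge0 // dzeta_le.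
  rewrite normrM normrX (ger0_norm z0) exprS -mulrA ler_piMl // mulr_ge0 //.
under eq_bigr do rewrite -mulr_sumr big_split -mulr_sumr /=.
rewrite -mulr_sumr mulrCA ler_wpM2l // big_split -mulr_sumr /= [leRHS]mulrDl mul1r.
by apply: lerD; rewrite ?asum_shift // ler_wpM2l ?mulr_ge0 // asum_le.
Qed.

End Sobolev.

Lemma asum_avs {R : realType} {n : nat} (L : seq 'I_n) (r a : nat) :
  exists2 C : R, 0 <= C & forall (I : Type) (f : seq 'I_n -> I -> 'rV[R]_n -> R),
  tower f -> exists2 M : R, 0 <= M & forall m p x, box x ->
    zeta x ^+ (a + size L) * asum f r p x <=
    C * avs m L (fun y => zeta y ^+ a * asum f (r + size L) p y) x + M * m.+1%:R^-1.
Proof.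
elim: L r => [|j L IH] r.
  by exists 1 => // I f tf; exists 0 => // m p x bx; rewrite /= !addn0 mul1r mul0r addr0.
have [C C0 {}IH] := IH r.+1.
pose B : R := 2 * (2 * (a + size L).+1%:R + 1).
have B0 : 0 <= B by rewrite mulr_ge0 // addr_ge0 // mulr_ge0.
exists (B * C) => [|I f tf]; first exact: mulr_ge0.
have [M M0 HM] := IH I f tf; have [M' M'0 HM'] := asum_av r (a + size L) j tf.
exists (B * M + M') => [|m p x bx]; first by rewrite addr_ge0 // mulr_ge0.
rewrite /= !addnS; apply: le_trans (HM' m p x bx) _.
rewrite avZ mulrA -/B mulrDl addrA lerD2r -!mulrA -mulrDr ler_wpM2l //.
have := av_le m j (HM m p) bx; rewrite avD avZ /= av_cst addSn => h.
by rewrite -mulrDr ler_wpM2l // addr_ge0 // mulr_ge0.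
Qed.

(** Average over all n coordinates, starting from the centre, where [zeta] is 1; then pass from
    first powers to squares by |y| <= 1 + y^2, applied entry by entry. *)
Lemma sobolev {R : realType} (n s : nat) :
  exists2 C : R, 0 <= C & forall (I : Type) (f : seq 'I_n -> I -> 'rV[R]_n -> R),
  tower f -> exists2 e : nat -> I -> R, negl e & forall m p,
    asum f s p 0 <= C * (1 + \sum_(1 <= i < (s + n).+1) wE f i m p) + e m p.
Proof.
(* After squaring, the weight is zeta^(2 (s + n) + 4), which is at most the weight of [wE] for every
   order up to s + n. *)
pose a := (s + n).+2; pose N := (s + n)%N.
have [C C0 H] := @asum_avs R n (enum 'I_n) s a.
have card0 : 0 <= \sum_(i < N) #|{: i.+1.-tuple 'I_n}|%:R :> R by exact: sumr_ge0.
exists (C * (\sum_(i < N) #|{: i.+1.-tuple 'I_n}|%:R + 1)) => [|I f tf].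
  by rewrite mulr_ge0 // addr_ge0.
have [M M0 HM] := H I f tf.
exists (fun m _ => M * m.+1%:R^-1).
  by exists M => m p; rewrite ger0_norm // mulr_ge0 // invr_ge0.
move=> m p; have := HM m p 0 box0; rewrite zeta0 expr1n mul1r => h.
apply: le_trans h _; rewrite lerD2r -mulrA ler_wpM2l // -/(Int m _).
have wE0 : 0 <= \sum_(1 <= i < N.+1) wE f i m p.
  apply: sumr_ge0 => i _; apply: Int_ge0 => x bx.
  by rewrite mulr_ge0 ?gsq_ge0 // exprn_ge0 //; have /andP[] := zeta_itv bx.
apply: (@le_trans _ _ (\sum_(i < N) #|{: i.+1.-tuple 'I_n}|%:R +
    \sum_(1 <= i < N.+1) wE f i m p)); last first.
  rewrite mulrDl mulrDr mulrDr !mulr1 mul1r.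
  rewrite -!addrA lerD2l addrA lerDr addr_ge0 ?mulr_ge0 //.
rewrite -(avs_cst m (enum 'I_n) (\sum_(i < N) _) 0) -/(Int m _) -Int_sum -IntD.
apply: Int_le => x bx; have /andP[z0 z1] := zeta_itv bx.
rewrite size_enum_ord -/N /asum big_add1 /= big_mkord mulr_sumr -big_split /=.
apply: ler_sum => i _; rewrite -sum1_card natr_sum mulr_sumr /gsq mulr_sumr -big_split /=.
apply: ler_sum => J _; set y := f J p x.
apply: (@le_trans _ _ (1 + zeta x ^+ (a * 2) * y ^+ 2)).
  rewrite exprM -exprMn.
  have -> : (zeta x ^+ a * y) ^+ 2 = (zeta x ^+ a * `|y|) ^+ 2.
    by rewrite !exprMn real_normK ?num_real.
  by have := sqr_ge0 (zeta x ^+ a * `|y| - 1); nra.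
rewrite lerD2l ler_wpM2r ?sqr_ge0 // ler_wiXn2l //.
have -> : (a * 2 = (2 * N).+4)%N by rewrite /a mulnC 2!mulnS.
by rewrite !ltnS leq_mul2l ltn_ord.
Qed.

(** * Evolution in time *)

Section Evolution.
Context {R : realType} (T : R).
Implicit Types (g dg : R -> R).

(** The derivative is required only at interior times because the comparison function involves sqrt
    t, which is not differentiable at 0; continuity up to the ends suffices for monotonicity. *)
Definition evol g dg : Prop :=
  (forall t : R, 0 <= t <= T -> g @ within `[0, T] (nbhs t) --> g t) /\
  (forall t : R, 0 < t < T -> is_derive t 1 g (dg t)).

Lemma evol_ext g dg g' dg' : (forall t, g t = g' t) -> (forall t, dg t = dg' t) ->
  evol g dg -> evol g' dg'.
Proof. by move=> /funext -> /funext ->. Qed.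

Lemma evol_cst c : evol (fun=> c) (fun=> 0).
Proof. by split=> t _; [exact: cvg_cst|exact: is_derive_cst]. Qed.

Lemma evolD g dg h dh : evol g dg -> evol h dh ->
  evol (fun t => g t + h t) (fun t => dg t + dh t).
Proof.
move=> [gc gd] [hc hd]; split=> t t0T; first by apply: cvgD; [exact: gc|exact: hc].
by apply: is_deriveD; [exact: gd|exact: hd].
Qed.

Lemma evolM g dg h dh : evol g dg -> evol h dh ->
  evol (fun t => g t * h t) (fun t => dg t * h t + g t * dh t).
Proof.
move=> [gc gd] [hc hd]; split=> t t0T; first by apply: cvgM; [exact: gc|exact: hc].
have [ex val] := is_deriveM (gd t t0T) (hd t t0T).
apply: DeriveDef; first exact: ex.
by apply: (etrans val); rewrite addrC; congr (_ + _); exact: mulrC.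
Qed.

Lemma evolZ c g dg : evol g dg -> evol (fun t => c * g t) (fun t => c * dg t).
Proof. by move=> /(evolM (evol_cst c)); apply: evol_ext => t //; rewrite mul0r add0r. Qed.

Lemma evol_sum (K : Type) (r : seq K) (P : pred K) (g dg : K -> R -> R) :
  (forall k, evol (g k) (dg k)) ->
  evol (fun t => \sum_(k <- r | P k) g k t) (fun t => \sum_(k <- r | P k) dg k t).
Proof.
move=> H; elim: r => [|k r IH].
  by apply: evol_ext (evol_cst 0) => t; rewrite big_nil.
case Pk : (P k); last by apply: evol_ext IH => t; rewrite big_cons Pk.
by apply: evol_ext (evolD (H k) IH) => t; rewrite big_cons Pk.
Qed.

Lemma evol_Int n m (g dg : R -> 'rV[R]_n -> R) :
  (forall x, evol (g^~ x) (dg^~ x)) ->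
  evol (fun t => Int m (g t)) (fun t => Int m (dg t)).
Proof.
rewrite /Int => H; elim: (enum _) 0 => [|j L IH] x /=; first exact: H.
by apply/evolZ/evol_sum => k; exact: IH.
Qed.

Lemma evol_nincr g dg : evol g dg -> (forall t : R, 0 < t < T -> dg t <= 0) ->
  forall t : R, 0 <= t <= T -> g t <= g 0.
Proof.
move=> [gc gd] dg0 t /andP[t0 tT].
have gw : {within `[0, T], continuous g}.
  by apply/subspace_continuousP => y; rewrite /= in_itv; exact: gc.
apply: (ler0_derive1_le_cc _ _ gw); rewrite ?in_itv /= ?lexx ?t0 ?tT ?(le_trans t0 tT) //.
  by move=> y; rewrite in_itv /= => /gd[].
by move=> y; rewrite in_itv /= derive1E => yT; have [_ ->] := gd y yT; exact: dg0.
Qed.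

End Evolution.

Lemma evol_sqrt {R : realType} (T : R) : evol T Num.sqrt (fun t => (2 * Num.sqrt t)^-1).
Proof.
split=> t t0T; last by apply: is_derive1_sqrt; case/andP: t0T.
by apply: cvg_within_filter; exact: sqrt_continuous.
Qed.

Lemma evol_id {R : realType} (T : R) : evol T id (fun=> 1).
Proof. by split=> t t0T; [exact: cvg_within|exact: is_derive_id]. Qed.

Lemma le_of_negl {R : realType} (a b M : R) :
  (forall m : nat, a <= b + M * m.+1%:R^-1) -> a <= b.
Proof.
move=> H; apply/ler_addgt0Pr => e e0.
have M0 : 0 < `|M| + 1 by rewrite ltr_wpDl.
have := H (Num.truncn ((`|M| + 1) / e)); set m := Num.truncn _ => h.
apply: le_trans h _; rewrite lerD2l ler_pdivrMr ?ltr0n //.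
have := truncnS_gt ((`|M| + 1) / e); rewrite -/m ltr_pdivrMr // mulrC => h.
by have := ler_norm M; lra.
Qed.

(** * The bound at the centre of the cube *)

Section HeatTower.
Context {R : realType} {n : nat}.

(** Restricting the parameter to times in [0, T] makes the O(1 / m) errors uniform on the whole time
    interval. *)
Definition heat_tower (T : R) (f : seq 'I_n -> R -> 'rV[R]_n -> R) : Prop :=
  tower (fun J (p : {t : R | 0 <= t <= T}) => f J (sval p)) /\
  forall J x, evol T (fun t => f J t x) (fun t => bih f J t x).

Lemma evol_wE T f i m : heat_tower T f -> evol T (wE f i m) (wdE f i m).
Proof.
move=> [_ ef]; apply: evol_Int => x; apply: evolZ; apply: evol_sum => J.
by apply: evol_ext (evolM (ef J x) (ef J x)) => t; rewrite ?expr2 //; ring.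
Qed.

Lemma heat_tower_bound (s : nat) (k0 k1 : R) : 0 <= k0 -> 0 <= k1 ->
  exists C : R, forall T f, heat_tower T f ->
  (forall x t, box x -> 0 < t <= T -> Num.sqrt t * gsq f 1 t x <= k0) ->
  (forall i x, box x -> (i <= s.+1 + n)%N -> gsq f i 0 x <= k1) ->
  forall t : R, 0 <= t <= T -> t <= 1 -> asum f s.+1 t 0 <= C.
Proof.
move=> k00 k10.
have [A [c [K [A0 c0 K0 H]]]] := @lyapunov R n (s + n).
have [C C0 S] := @sobolev R n s.+1.
pose V := \sum_(1 <= i < (s + n).+2) (A i)^-1.
have V0 : 0 <= V by apply: sumr_ge0 => i _; rewrite invr_ge0 ltW.
pose Q := (\sum_(1 <= i < (s + n).+2) A i) * k1 + 2 * K * k0.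
exists (C * (1 + V * Q)) => T f hf h0 h1 t tT t1.
have [tf _] := hf.
have [e [M Me] eH0] := H _ _ tf; have [e' [M' Me'] eS] := S _ _ tf.
apply: (@le_of_negl _ _ _ (C * (V * M) + M')) => m; set h := m.+1%:R^-1.
have eH y : 0 <= y <= T -> \sum_(1 <= i < (s + n).+2) A i * wdE f i m y <=
    - c * (wH f (s + n).+3 m y + wH f (s + n).+2 m y) + K * wH f 1 m y +
    M * h.
  move=> yT; apply: le_trans (eH0 m (exist _ y yT)) _; apply: lerD => //.
  exact: le_trans (ler_norm _) (Me m _).
pose E t := \sum_(1 <= i < (s + n).+2) A i * wE f i m t.
have M0 : 0 <= M * h by apply: le_trans (Me m (exist _ t tT)).
have Et : E t <= Q + M * h.
  (* The derivative of 2 K k0 sqrt t is K k0 / sqrt t, which dominates K H_1; the linear term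
     compensates the grid error. Hence W does not increase. *)
  pose W t := E t + (- (2 * K * k0) * Num.sqrt t + - (M * h) * t).
  have eW : evol T W (fun t => \sum_(1 <= i < (s + n).+2) A i * wdE f i m t +
      (- (2 * K * k0) * (2 * Num.sqrt t)^-1 + - (M * h) * 1)).
    apply: evolD; first by apply: evol_sum => i; apply/evolZ/evol_wE.
    by apply: evolD; apply: evolZ; [exact: evol_sqrt|exact: evol_id].
  have W0 : W t <= W 0.
    apply: (evol_nincr eW) => // y /andP[y0 yT] /=.
    have yT' : 0 <= y <= T by rewrite !ltW.
    have e3 := eH y yT'.
    have sy : 0 < Num.sqrt y by rewrite sqrtr_gt0.
    have : wH f 1 m y <= k0 / Num.sqrt y.
      rewrite -(avs_cst m (enum 'I_n) (k0 / _) 0); apply: Int_le => x bx.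
      rewrite ler_pdivlMr // mulrC.
      have /andP[z0 z1] := zeta_itv bx.
      apply: le_trans (h0 x y bx _); last by rewrite y0 ltW.
      by rewrite ler_wpM2l ?sqrtr_ge0 // ler_piMl ?gsq_ge0 // exprn_ile1.
    move=> /(ler_wpM2l K0) e4.
    have -> : - (2 * K * k0) * (2 * Num.sqrt y)^-1 = - (K * (k0 / Num.sqrt y)).
      by field; rewrite gt_eqF.
    have : 0 <= c * (wH f (s + n).+3 m y + wH f (s + n).+2 m y).
      by rewrite mulr_ge0 ?addr_ge0 ?wH_ge0 // ltW.
    move=> e5; apply: le_trans (lerD e3 (lexx _)) _; lra.
  have E0 : E 0 <= (\sum_(1 <= i < (s + n).+2) A i) * k1.
    rewrite mulr_suml; apply: ler_sum_nat => i /andP[_ iN].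
    rewrite ler_pM2l // -[leRHS](avs_cst m (enum 'I_n) k1 0); apply: Int_le => x bx.
    have /andP[z0 z1] := zeta_itv bx.
    by apply: le_trans (h1 i x bx _) => //; rewrite ler_piMl ?gsq_ge0 // exprn_ile1.
  move: W0; rewrite /W sqrtr0 !mulr0 !addr0 /Q.
  have s1 : Num.sqrt t <= 1 by rewrite -[leRHS]sqrtr1 ler_sqrt.
  have s2 : K * k0 * Num.sqrt t <= K * k0 by rewrite ler_piMr // mulr_ge0.
  have s3 : M * h * t <= M * h by rewrite ler_piMr.
  lra.
have wE0 i : 0 <= wE f i m t.
  apply: Int_ge0 => x bx; rewrite mulr_ge0 ?gsq_ge0 // exprn_ge0 //.
  by have /andP[] := zeta_itv bx.
have wV : \sum_(1 <= i < (s + n).+2) wE f i m t <= V * E t.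
  rewrite mulr_suml; apply: ler_sum_nat => i iN.
  rewrite mulrC ler_pdivlMr // mulrC /E (bigD1_seq i) ?mem_index_iota ?iota_uniq //=.
  by rewrite lerDl; apply: sumr_ge0 => j _; rewrite mulr_ge0 // ltW.
have := eS m (exist _ t tT); have := ler_norm (e' m (exist _ t tT)).
have := Me' m (exist _ t tT) => e1 e2 e3.
apply: le_trans e3 _ => /=.
apply: (@le_trans _ _ (C * (1 + V * (Q + M * h)) + M' * h)); last first.
  by rewrite le_eqVlt; apply/orP; left; apply/eqP; ring.
apply: lerD; last by apply: le_trans e1.
by rewrite ler_wpM2l // lerD2l; apply: le_trans wV _; rewrite ler_wpM2l.
Qed.

End HeatTower.

(** * One-sided derivatives and mixed partials *)

Section DerivativeInSet.
Context {R : realType}.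
Implicit Types (A : set R) (g dg : R -> R).

(** Derivative relative to [A], written without quotients: it covers the one-sided derivatives at
    times 0 and T, and restricts directly to subsets. *)
Definition der_in A g (s D : R) : Prop :=
  forall e : R, 0 < e -> exists2 d : R, 0 < d &
    forall r, A r -> `|r - s| < d -> `|g r - g s - D * (r - s)| <= e * `|r - s|.

Lemma der_in_subset A B g s D : B `<=` A -> der_in A g s D -> der_in B g s D.
Proof.
by move=> BA h e /h[d d0 H]; exists d => // r /BA; exact: H.
Qed.

Lemma der_in_ext A g g' s D : (forall r, A r -> g r = g' r) -> A s ->
  der_in A g s D -> der_in A g' s D.
Proof.
by move=> gg As h e /h[d d0 H]; exists d => // r Ar rs; rewrite -!gg //; exact: H.
Qed.

Lemma der_inD A f g s D D' : der_in A f s D -> der_in A g s D' ->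
  der_in A (fun r => f r + g r) s (D + D').
Proof.
move=> hf hg e e0; have e20 : 0 < e / 2 by rewrite divr_gt0.
have [d d0 H] := hf _ e20; have [d' d'0 H'] := hg _ e20.
exists (Num.min d d') => [|r Ar]; first by rewrite lt_min d0.
rewrite lt_min => /andP[/H{}H /H'{}H'].
have := H Ar; have := H' Ar; set x := g r - _ - _; set y := f r - _ - _ => h1 h2.
rewrite (_ : _ - _ = y + x); last by rewrite /x /y; ring.
by apply: (le_trans (ler_normD _ _)); lra.
Qed.

Lemma der_inZ A g s D c : der_in A g s D -> der_in A (fun r => c * g r) s (c * D).
Proof.
move=> h e e0; have c0 : 0 < `|c| + 1 by rewrite ltr_wpDl.
have [d d0 H] := h _ (divr_gt0 e0 c0); exists d => // r Ar rs.
rewrite -mulrA -!mulrBr normrM; apply: le_trans (ler_wpM2l (normr_ge0 c) (H r Ar rs)) _.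
rewrite mulrA ler_wpM2r // mulrCA ler_piMr ?(ltW e0) // ler_pdivrMr //.
by rewrite mul1r lerDl.
Qed.

Lemma der_in_affine A g s D (a b : R) : a != 0 -> der_in A g (a * s + b) D ->
  der_in [set r | A (a * r + b)] (fun r => g (a * r + b)) s (a * D).
Proof.
move=> a0 h e e0; have na : 0 < `|a| by rewrite normr_gt0.
have [d d0 H] := h _ (divr_gt0 e0 na); exists (d / `|a|) => [|r /= Ar]; first exact: divr_gt0.
rewrite ltr_pdivlMr // -normrM => rs; have E : a * r + b - (a * s + b) = (r - s) * a by ring.
have := H _ Ar; rewrite E => /(_ rs).
rewrite normrM [e / _ * _](_ : _ = e * `|r - s|); last by field; rewrite gt_eqF.
by rewrite [D * _](_ : _ = a * D * (r - s)) //; ring.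
Qed.

Lemma der_in_cvg A g s D : A s -> der_in A g s D -> g @ within A (nbhs s) --> g s.
Proof.
move=> As h; apply/cvgrPdist_le => e e0.
have [d d0 H] := h 1 ltr01.
have D0 : 0 < 1 + `|D| by rewrite ltr_pwDl.
rewrite near_withinE; apply/nbhs_ballP; exists (Num.min d (e / (1 + `|D|))) => /=.
  by rewrite lt_min d0 divr_gt0.
move=> r /=; rewrite /ball /= lt_min distrC => /andP[rd re] Ar.
have := H r Ar rd; rewrite mul1r => h1.
rewrite distrC (_ : g r - g s = (g r - g s - D * (r - s)) + D * (r - s)); last by ring.
apply: (le_trans (ler_normD _ _)); rewrite normrM.
rewrite ltr_pdivlMr // in re; lra.
Qed.

Lemma der_in_is_derive A g s D : nbhs s A -> der_in A g s D -> is_derive s 1 g D.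
Proof.
move=> /nbhs_ballP[d' /= d'0 As] h.
have L : (fun h : R => h^-1 *: ((g \o shift s) (h *: 1) - g s)) @ 0^' --> D.
  apply/cvgrPdist_le => e e0; have [d d0 H] := h _ e0.
  rewrite near_withinE; apply/nbhs_ballP; exists (Num.min d d') => /=; first by rewrite lt_min d0.
  move=> r; rewrite /ball /= sub0r normrN lt_min => /andP[rd rd'] r0.
  have rE : r + s - s = r by rewrite addrK.
  have := H (r + s); rewrite rE => /(_ (As _ _) rd).
  rewrite {1}/ball /= opprD addrCA subrr addr0 normrN => /(_ rd') h1.
  have r1 : 0 < `|r| by rewrite normr_gt0.
  rewrite -(ler_pM2r r1) -normrM; apply: le_trans h1.
  rewrite [r *: 1]mulr1 -normrN le_eqVlt; apply/orP; left; apply/eqP; congr `|_|.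
  by rewrite /GRing.scale /=; field.
by apply: DeriveDef; [apply/cvg_ex; exists D|apply: cvg_lim].
Qed.

(** The intermediate point is given as a fraction of the way from a to b, so the two points may come
    in either order or coincide. *)
Lemma der_in_mvt A g dg a b : is_interval A -> (forall s, A s -> der_in A g s (dg s)) ->
  A a -> A b -> exists2 th, 0 <= th <= 1 &
    A (a + th * (b - a)) /\ g b - g a = dg (a + th * (b - a)) * (b - a).
Proof.
move=> iA h.
wlog ab : a b / a <= b => [H Aa Ab|Aa Ab].
  have [ab|/ltW ba] := leP a b; first exact: H.
  have [th th01 [Ac E]] := H _ _ ba Ab Aa.
  have cE : b + th * (a - b) = a + (1 - th) * (b - a) by ring.
  exists (1 - th); first by lra.
  by rewrite -cE; split=> //; rewrite -opprB E -mulrN opprB.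
move: ab; rewrite le_eqVlt => /predU1P[<-|ab].
  by exists 0; rewrite ?lexx ?ler01 // !subrr !mulr0 addr0.
have sub : `[a, b]%classic `<=` A.
  by move=> r /=; rewrite in_itv /= => rab; apply: iA rab.
have [||c] := @MVT R g dg a b ab.
- move=> r rab; apply: (@der_in_is_derive `[a, b]%classic).
    by apply: filterS (near_in_itvoo rab) => z; exact: subset_itv_oo_cc.
  by apply: (der_in_subset sub); apply/h/sub; exact: subset_itv_oo_cc.
- apply/subspace_continuousP => r rab; apply: der_in_cvg => //.
  by apply: (der_in_subset sub); apply/h/sub.
rewrite in_itv /= => /andP[ac cb] E; have ba0 : 0 < b - a by rewrite subr_gt0.
exists ((c - a) / (b - a)).
  by rewrite divr_ge0 ?(ltW ba0) ?subr_ge0 ?(ltW ac) //= ler_pdivrMr // mul1r; lra.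
rewrite divfK ?gt_eqF // addrC subrK; split => //.
by apply: (iA _ _ Aa Ab); rewrite !ltW.
Qed.

(* Only one of the two mixed derivatives is assumed to exist; the conclusion
   contains the existence of the other. *)
Lemma schwarz A (phi phis phisy : R -> R -> R) (phiy : R -> R) (s0 : R) :
  is_interval A -> A s0 ->
  (forall y s, A s -> der_in A (phi y) s (phis y s)) ->
  (forall s, A s -> der_in setT (phi^~ s) 0 (phiy s)) ->
  (forall y s, A s -> der_in setT (phis^~ s) y (phisy y s)) ->
  (forall e, 0 < e -> exists2 d, 0 < d & forall y s, A s ->
     `|y| < d -> `|s - s0| < d -> `|phisy y s - phisy 0 s0| <= e) ->
  der_in A phiy s0 (phisy 0 s0).
Proof.
move=> iA As0 hs hy hsy cont e e0; have [d d0 H] := cont e e0.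
exists d => // r Ar rd; set L := phisy 0 s0.
apply/ler_addgt0Pr => e' e'0; have e4 : 0 < e' / 2 by rewrite divr_gt0.
have [d1 d10 H1] := hy r Ar _ e4; have [d2 d20 H2] := hy s0 As0 _ e4.
(* The increment h in y is chosen after r, so small that the expansions in y at r and at s0 are each
   off by at most e' h / 2. The second difference of [phi] is then computed by two mean values, and
   h is divided out. *)
pose h := Num.min d (Num.min d1 d2) / 2.
have h0 : 0 < h by rewrite divr_gt0 // !lt_min d0 d10 d20.
have [hd [hd1 hd2]] : h < d /\ h < d1 /\ h < d2.
  have := h0; rewrite /h ltr_pdivlMr // mul0r => m0.
  have : Num.min d (Num.min d1 d2) / 2 < Num.min d (Num.min d1 d2) by lra.
  by rewrite !lt_min => /and3P[].
have nh : `|h| = h by rewrite gtr0_norm.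
clearbody h.
have psi s : A s -> der_in A (fun s => phi h s + -1 * phi 0 s) s (phis h s + -1 * phis 0 s).
  by move=> As; apply: der_inD; [exact: hs|apply/der_inZ/hs].
have [th th01 [Ac E1]] := der_in_mvt iA psi As0 Ar.
set c := s0 + _ in Ac E1.
have cd : `|c - s0| < d.
  rewrite /c addrC addKr normrM; apply: le_lt_trans rd.
  by rewrite ler_piMl // ger0_norm; case/andP: th01.
have iT : is_interval (@setT R) by [].
have [eta eta01 [_ E2]] := der_in_mvt iT (fun y _ => hsy y c Ac) (I : setT 0) (I : setT h).
have yd : `|0 + eta * (h - 0)| < d.
  rewrite add0r subr0 normrM nh; apply: le_lt_trans hd.
  by rewrite ler_piMl ?(ltW h0) // ger0_norm; case/andP: eta01.
have := H _ _ Ac yd cd; rewrite -/L; set Q := phisy _ c in E2 * => QL.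
have := H1 h I; have := H2 h I; rewrite !subr0 nh => /(_ hd2) e2 /(_ hd1) e1.
have key : (phiy r - phiy s0 - L * (r - s0)) * h =
    (Q - L) * (r - s0) * h - (phi h r - phi 0 r - phiy r * h)
     + (phi h s0 - phi 0 s0 - phiy s0 * h).
  move: E1; rewrite !mulN1r E2 subr0 => E1.
  have -> : (Q - L) * (r - s0) * h = Q * h * (r - s0) - L * (r - s0) * h by ring.
  by rewrite -E1; ring.
rewrite -(ler_pM2r h0) -{1}nh -normrM key.
apply: (le_trans (ler_normD _ _)); apply: (le_trans (lerD (ler_normB _ _) (lexx _))).
rewrite !normrM nh.
have : `|Q - L| * `|r - s0| * h <= e * `|r - s0| * h.
  by rewrite ler_wpM2r ?(ltW h0) // ler_wpM2r.
lra.
Qed.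

End DerivativeInSet.

(** * Spatial derivatives of the flow *)

Section Lines.
Context {R : realType} {n : nat}.
Implicit Types (f : 'rV[R]_n -> R) (x v : 'rV[R]_n).

Lemma derivable_line f x v s : derivable f (x + s *: v) v ->
  der_in setT (fun y => f (x + y *: v)) s ('D_v f (x + s *: v)).
Proof.
move=> df e e0; move: (df : _ --> 'D_v f (x + s *: v)) => /cvgrPdist_le/(_ _ e0).
rewrite near_withinE => /nbhs_ballP[d /= d0 H]; exists d => // r _ rs.
have [->|rs0] := eqVneq r s; first by rewrite !subrr mulr0 subrr !normr0 mulr0.
have r0 : r - s != 0 by rewrite subr_eq0.
have := H (r - s); rewrite /ball /= sub0r normrN => /(_ rs r0).
rewrite (_ : (r - s) *: v + (x + s *: v) = x + r *: v); last first.
  by apply/rowP => i; rewrite !mxE; ring.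
set D := 'D_v f _; set a := f _; set b := f _ => h.
have -> : a - b - D * (r - s) = - ((D - (r - s)^-1 *: (a - b)) * (r - s)).
  by rewrite /GRing.scale /=; field.
by rewrite normrN normrM ler_wpM2r.
Qed.

Lemma is_derive_line f x v D :
  der_in setT (fun y => f (x + y *: v)) 0 D -> is_derive x v f D.
Proof.
move=> h.
have L : (fun h : R => h^-1 *: ((f \o shift x) (h *: v) - f x)) @ 0^' --> D.
  apply/cvgrPdist_le => e e0; have [d d0 H] := h _ e0.
  rewrite near_withinE; apply/nbhs_ballP; exists d => //= r.
  rewrite /ball /= sub0r normrN => rd r0.
  have := H r I; rewrite subr0 scale0r addr0 => /(_ rd) h1.
  have r1 : 0 < `|r| by rewrite normr_gt0.
  rewrite -(ler_pM2r r1) -normrM; apply: le_trans h1.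
  rewrite (addrC (r *: v)) -normrN le_eqVlt; apply/orP; left; apply/eqP; congr `|_|.
  by rewrite /GRing.scale /=; field.
by apply: DeriveDef; [apply/cvg_ex; exists D|apply: cvg_lim].
Qed.

Lemma is_derive_bigsum (Q : Type) (r : seq Q) (f : Q -> 'rV[R]_n -> R) x v (D : Q -> R) :
  (forall q, is_derive x v (f q) (D q)) ->
  is_derive x v (fun y => \sum_(q <- r) f q y) (\sum_(q <- r) D q).
Proof.
move=> H; elim: r => [|q r IH].
  rewrite big_nil (_ : (fun y => _) = fun=> 0); first exact: is_derive_cst.
  by apply/funext => y; rewrite big_nil.
rewrite big_cons (_ : (fun y => _) = f q + fun y => \sum_(q <- r) f q y).
  exact: is_deriveD.
by apply/funext => y; rewrite big_cons.
Qed.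

Lemma time_derivable_der_in (T t : R) (w : 'rV[R]_n -> R -> R) x :
  time_derivable T w x t -> der_in `[0, T] (w x) t (time_deriv T w x t).
Proof.
move=> df e e0; move: (df : _ --> time_deriv T w x t) => /cvgrPdist_le/(_ _ e0).
rewrite !near_withinE => /nbhs_ballP[d /= d0 H]; exists d => // r Ar rt.
have [->|rt0] := eqVneq r t; first by rewrite !subrr mulr0 subrr !normr0 mulr0.
have r0 : r - t != 0 by rewrite subr_eq0.
have := H r; rewrite /ball /= distrC => /(_ rt rt0 Ar); rewrite /time_slope.
set D := time_deriv _ _ _ _ => h.
have -> : w x r - w x t - D * (r - t) = - ((D - (w x r - w x t) / (r - t)) * (r - t)).
  by field.
by rewrite normrN normrM ler_wpM2r.
Qed.

End Lines.

Section Flow.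
Context {R : realType} {n : nat} (T : R) (u : 'rV[R]_n -> R -> R).
Context (flow : biharmonic_heat_flow T u).
Implicit Types (J K : seq 'I_n) (j k l : 'I_n) (x : 'rV[R]_n) (t : R).

Let F J t : 'rV[R]_n -> R := partials J (u^~ t).

Lemma st_partials_cat J D x t :
  st_partials T (map Some J ++ D) u x t = partials J ((st_partials T D u)^~ t) x.
Proof.
elim: J x => [//|j J IH] x /=; rewrite /partials /=.
by congr ('D_ _ _ _); apply/funext => y; exact: IH.
Qed.

Lemma st_partials_space J x t : st_partials T (map Some J) u x t = F J t x.
Proof. by rewrite -[map _ _]cats0 st_partials_cat. Qed.

Lemma smooth_continuous D x t e : 0 <= t <= T -> 0 < e ->
  exists2 d, 0 < d & forall (y : 'rV[R]_n) (s : R),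
    0 <= s <= T -> (forall i, `|y 0 i - x 0 i| < d) ->
    `|s - t| < d -> `|st_partials T D u y s - st_partials T D u x t| <= e.
Proof.
move=> tT e0; have [cD _] := flow.1 D; move/subspace_continuousP : cD => /(_ (x, t) tT).
move=> /cvgrPdist_le/(_ _ e0); rewrite near_withinE => /nbhs_ballP[d /= d0 H].
exists d => // y s sT yx st; rewrite distrC; apply: (H (y, s)) => //.
split => /=; last by rewrite /ball /= distrC.
by split=> // i j; rewrite (ord1 i) /ball /= distrC.
Qed.

Lemma partials_derivable J j x t : 0 <= t <= T -> derivable (F J t) x (delta_mx 0 j).
Proof.
move=> tT; have [_ /(_ (Some j) x t tT)] := flow.1 (map Some J).
by rewrite /= (_ : (st_partials T _ u)^~ t = F J t) //; apply/funext => y;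
  rewrite st_partials_space.
Qed.

Lemma partials_line J j x t s : 0 <= t <= T ->
  der_in setT (fun y => F J t (x + y *: delta_mx 0 j)) s
    (F (j :: J) t (x + s *: delta_mx 0 j)).
Proof. by move=> tT; apply: derivable_line; exact: partials_derivable. Qed.

Lemma delta_entry_le j i (y : R) : `|(y *: delta_mx 0 j : 'rV[R]_n) 0 i| <= `|y|.
Proof.
rewrite !mxE normrM eqxx /=; case: (i == j); first by rewrite normr1 mulr1.
by rewrite normr0 mulr0.
Qed.

Lemma partials_swap J k l t : 0 <= t <= T -> F [:: k, l & J] t = F [:: l, k & J] t.
Proof.
move=> tT; apply/funext => x.
pose ek : 'rV[R]_n := delta_mx 0 k; pose el : 'rV[R]_n := delta_mx 0 l.
have := @schwarz R setT (fun y s => F J t (x + s *: ek + y *: el))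
  (fun y s => F (k :: J) t (x + s *: ek + y *: el))
  (fun y s => F [:: l, k & J] t (x + s *: ek + y *: el))
  (fun s => F (l :: J) t (x + s *: ek)) 0.
rewrite !scale0r !addr0 => S; suff /is_derive_line[_ E] : der_in setT
  (fun s => F (l :: J) t (x + s *: ek)) 0 (F [:: l, k & J] t x) by exact: E.
apply: S => // [y s _|s _|y s _|e e0].
- rewrite (addrAC x (s *: ek)).
  apply: der_in_ext (partials_line J k (x + y *: el) s tT) => // r _.
  by rewrite (addrAC x (r *: ek)).
- by have := @partials_line J l (x + s *: ek) t 0 tT; rewrite scale0r addr0.
- exact: partials_line.
have [d d0 H] := smooth_continuous (map Some [:: l, k & J]) x tT e0.
(* Half of d for each of the two displacements, which add up in one coordinate when k = l. *)
exists (d / 2) => [|y s _ yd sd]; first exact: divr_gt0.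
rewrite -!st_partials_space; apply: H => // [i|]; last by rewrite subrr normr0.
rewrite -addrA mxE addrAC subrr add0r mxE.
apply: (le_lt_trans (ler_normD _ _)).
rewrite subr0 in sd.
have := delta_entry_le k i s; have := delta_entry_le l i y; rewrite -/ek -/el; lra.
Qed.

Lemma partials_move J K k t : 0 <= t <= T -> F (J ++ k :: K) t = F (k :: J ++ K) t.
Proof.
move=> tT; elim: J => [//|j J IH]; rewrite -(partials_swap _ _ _ tT) /=.
by congr (partial j _).
Qed.

Lemma partials_sum (Q : finType) (c : R) (S : Q -> seq 'I_n) J t : 0 <= t <= T ->
  partials J (fun x => \sum_q c * F (S q) t x) = fun x => \sum_q c * F (J ++ S q) t x.
Proof.
move=> tT; elim: J => [//|j J IH].
rewrite (_ : partials (j :: J) _ =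
  partial j (partials J (fun x => \sum_q c * F (S q) t x))) //.
rewrite IH; apply/funext => x.
have d q : is_derive x (delta_mx 0 j) (fun y => c * F (J ++ S q) t y)
    (c * F (j :: J ++ S q) t x).
  by apply: is_deriveZ; apply: derivableP; exact: partials_derivable.
have [_ E] := is_derive_bigsum (index_enum Q) d; exact: E.
Qed.

Lemma laplacian_sum t x : 0 <= t <= T ->
  laplacian (laplacian (u^~ t)) x =
  \sum_(q : 'I_n * 'I_n) F [:: q.1; q.1; q.2; q.2] t x.
Proof.
move=> tT; rewrite /laplacian -(pair_bigA _ (fun k l => F [:: k; k; l; l] t x)) /=.
apply: eq_bigr => k _.
have := @partials_sum 'I_n 1 (fun l => [:: l; l]) [:: k; k] t tT.
move=> /(congr1 (fun g => g x)) E.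
transitivity (\sum_l 1 * F ([:: k; k] ++ [:: l; l]) t x).
  rewrite -E; congr (partial k (partial k _) x).
  by apply/funext => y; apply: eq_bigr => l _; rewrite mul1r.
by apply: eq_bigr => l _; rewrite mul1r.
Qed.

(** Smoothness makes the space derivatives of the time derivative exist and be continuous. [schwarz]
    on [0, T] then moves the time derivative outwards past one space derivative at a time, up to the
    end times. *)
Lemma partials_time J x t : 0 <= t <= T ->
  der_in `[0, T] (fun s => F J s x) t (- \sum_k \sum_l F [:: k, k, l, l & J] t x).
Proof.
move=> tT; pose G J s := partials J (st_partials T [:: None] u ^~ s).
have GE s y : 0 <= s <= T -> G J s y = - \sum_k \sum_l F [:: k, k, l, l & J] s y.
  move=> sT; rewrite /G (_ : _ ^~ s = fun z => \sum_(q : 'I_n * 'I_n)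
      (-1) * F [:: q.1; q.1; q.2; q.2] s z).
    rewrite partials_sum // -mulr_sumr mulN1r pair_bigA; congr (- _).
    apply: eq_bigr => q _; rewrite (partials_move _ _ _ sT).
    rewrite /= (_ : F _ s = F (q.1 :: q.2 :: q.2 :: J) s) //.
    rewrite (partials_move _ _ _ sT) /= (_ : F _ s = F (q.2 :: q.2 :: J) s) //.
    rewrite (partials_move _ _ _ sT) /= (_ : F _ s = F (q.2 :: J) s) //.
    by rewrite (partials_move _ _ _ sT) cats0.
  apply/funext => z; rewrite -mulr_sumr mulN1r -laplacian_sum //.
  exact: (flow.2 z s sT).
rewrite -(GE t x tT); elim: J x t tT {GE} => [|j J IH] x t tT.
  have [_ /(_ None x t tT)] := flow.1 [::]; exact: time_derivable_der_in.
pose ej : 'rV[R]_n := delta_mx 0 j.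
have GD s y : G J s y = st_partials T (map Some J ++ [:: None]) u y s.
  by rewrite st_partials_cat.
have := @schwarz R `[0, T]%classic (fun y s => F J s (x + y *: ej))
  (fun y s => G J s (x + y *: ej)) (fun y s => G (j :: J) s (x + y *: ej))
  (fun s => F (j :: J) s x) t.
rewrite scale0r addr0; apply => //= [|y s sT|s sT|y s sT|e e0].
- exact: interval_is_interval.
- by apply: IH; rewrite in_itv in sT.
- have := @partials_line J j x s 0; rewrite scale0r addr0; apply.
  by rewrite in_itv in sT.
- apply: derivable_line; rewrite in_itv in sT.
  have [_ /(_ (Some j) (x + y *: ej) s sT)] := flow.1 (map Some J ++ [:: None]).
  by rewrite /= (_ : (st_partials T _ u)^~ s = G J s) //; apply/funext => z; rewrite GD.
have [d d0 H] := smooth_continuous (map Some (j :: J) ++ [:: None]) x tT e0.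
exists d => // y s; rewrite /= in_itv => sT yd st.
rewrite (_ : partial j (G J s) _ =
  st_partials T (map Some (j :: J) ++ [:: None]) u (x + y *: ej) s); last first.
  by rewrite st_partials_cat.
rewrite (_ : partial j (G J t) x =
  st_partials T (map Some (j :: J) ++ [:: None]) u x t); last first.
  by rewrite st_partials_cat.
apply: H => // i; rewrite mxE addrAC subrr add0r; apply: le_lt_trans yd.
exact: delta_entry_le.
Qed.

(** By compactness; the cube of half-width 2 contains x0 + sg y for x0 and y in the box and sg <=
    1. *)
Lemma partials_bounded J : exists2 M : R, 0 <= M & forall x t, 0 <= t <= T ->
  (forall i, -2 <= x 0 i <= 2) -> `|F J t x| <= M.
Proof.
have [cD _] := flow.1 (map Some J).
pose B := [set x : 'rV[R]_n | forall i, `[-2, 2]%classic (x 0 i)].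
have cB : compact (B `*` `[0, T]%classic).
  apply: compact_setX; last exact: segment_compact.
  by apply: (@rV_compact R n (fun _ => `[-2, 2]%classic)) => i; exact: segment_compact.
have sub : B `*` `[0, T]%classic `<=` [set p : 'rV[R]_n * R | 0 <= p.2 <= T].
  by move=> [x t] [_] /=; rewrite in_itv.
have := continuous_compact (continuous_subspaceW sub cD) cB.
move=> /compact_bounded [M [_ MH]]; exists (`|M| + 1) => [|x t tT xb].
  by rewrite addr_ge0.
apply: (MH (`|M| + 1)); first by rewrite ltr_pwDr // ler_norm.
exists (x, t); last by rewrite /= st_partials_space.
by split=> [i|]; rewrite /= in_itv //=; exact: xb.
Qed.

End Flow.

(** * Rescaling and conclusion *)

Section Enorm.
Context {R : realType} {n : nat}.
Implicit Types (x w : 'rV[R]_n).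

Lemma enorm_ge0 x : 0 <= enorm x.
Proof. exact: sqrtr_ge0. Qed.

Lemma enorm_sq x : enorm x ^+ 2 = \sum_i x 0 i ^+ 2.
Proof. by rewrite sqr_sqrtr // sumr_ge0 // => i _; exact: sqr_ge0. Qed.

Lemma entry_le_enorm x i : `|x 0 i| <= enorm x.
Proof.
rewrite -ler_sqr ?nnegrE ?enorm_ge0 // real_normK ?num_real // enorm_sq (bigD1 i) //=.
by rewrite lerDl; apply: sumr_ge0 => j _; exact: sqr_ge0.
Qed.

Lemma enormD x w : enorm (x + w) <= enorm x + \sum_i `|w 0 i|.
Proof.
have S0 : 0 <= \sum_i `|w 0 i| by exact: sumr_ge0.
rewrite -ler_sqr ?nnegrE ?enorm_ge0 ?addr_ge0 ?enorm_ge0 // enorm_sq.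
have -> : (enorm x + \sum_i `|w 0 i|) ^+ 2 = enorm x ^+ 2 +
    \sum_i (2 * enorm x * `|w 0 i| + (\sum_j `|w 0 j|) * `|w 0 i|).
  by rewrite big_split -!mulr_sumr /=; ring.
rewrite enorm_sq -big_split; apply: ler_sum => i _ /=; rewrite mxE.
have xi := entry_le_enorm x i.
have wi : `|w 0 i| <= \sum_j `|w 0 j| by rewrite (bigD1 i) //= lerDl; exact: sumr_ge0.
have := ler_wpM2r (normr_ge0 (w 0 i)) wi; have := ler_wpM2r (normr_ge0 (w 0 i)) xi.
have : x 0 i * w 0 i <= `|x 0 i| * `|w 0 i| by rewrite -normrM ler_norm.
have : w 0 i ^+ 2 = `|w 0 i| * `|w 0 i| by rewrite -expr2 real_normK ?num_real.
rewrite sqrrD; move=> ->; lra.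
Qed.

Lemma closure_eball x : closure (eball 0 1) x -> enorm x <= 1.
Proof.
move=> cx; rewrite leNgt; apply/negP => x1.
(* Neighbourhoods are sup-norm balls; moving every coordinate by less than d changes the Euclidean
   norm by at most n d <= |x| - 1. *)
pose d := (enorm x - 1) / n.+1%:R; have d0 : 0 < d by rewrite divr_gt0 ?subr_gt0 ?ltr0n.
have [y [/= y1 [_ xy]]] := cx _ (nbhsx_ballx x d d0).
move: y1; rewrite /eball /= subr0 => y1.
have := enormD y (x - y); rewrite addrC subrK => h.
have : \sum_i `|(x - y) 0 i| <= \sum_(i < n) d.
  by apply: ler_sum => i _; rewrite !mxE ltW //; exact: xy.
rewrite sumr_const card_ord -mulr_natl => h'.
have : n%:R * d <= enorm x - 1.
  by rewrite /d mulrCA ler_piMr ?subr_ge0 ?(ltW x1) // ler_pdivrMr ?ltr0n // mul1r ler_nat.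
lra.
Qed.

End Enorm.

Lemma sqrt_sum_sq_le {R : realType} (K : finType) (g : K -> R) :
  Num.sqrt (\sum_k g k ^+ 2) <= \sum_k `|g k|.
Proof.
have S0 : 0 <= \sum_k `|g k| by exact: sumr_ge0.
rewrite -[leRHS](ger0_norm S0) -sqrtr_sqr ler_sqrt ?sqr_ge0 // expr2 mulr_sumr.
apply: ler_sum => k _; rewrite -real_normK ?num_real // expr2 ler_wpM2r //.
by rewrite (bigD1 k) //= lerDl; exact: sumr_ge0.
Qed.

(** * Parabolic rescaling about a point *)

Section Rescaling.
Context {R : realType} {n : nat} (T : R) (u : 'rV[R]_n -> R -> R).
Context (flow : biharmonic_heat_flow T u).
Context (x0 : 'rV[R]_n) (sg : R).
Context (sg0 : 0 < sg) (sg1 : sg <= 1) (x0b : box x0).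

(** The derivatives of u(x0 + sg y, sg^4 tau) in y, with the chain-rule factor built in. The flow is
    preserved because four more letters in [J] give the same factor sg^4 as one time derivative. *)
Definition rescaled (J : seq 'I_n) (tau : R) (y : 'rV[R]_n) : R :=
  sg ^+ size J * partials J (u^~ (sg ^+ 4 * tau)) (x0 + sg *: y).

Lemma rescaled_time tau : 0 <= tau <= T / sg ^+ 4 -> 0 <= sg ^+ 4 * tau <= T.
Proof.
move=> /andP[t0 tT]; have s4 : 0 < sg ^+ 4 by rewrite exprn_gt0.
by rewrite mulr_ge0 ?(ltW s4) //= mulrC -ler_pdivlMr.
Qed.

Lemma rescaled_line J j tau y s : 0 <= tau <= T / sg ^+ 4 ->
  der_in setT (fun z => rescaled J tau (upd y j z)) s (rescaled (j :: J) tau (upd y j s)).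
Proof.
move=> /rescaled_time tT.
have E z : x0 + sg *: upd y j z = x0 + sg *: upd y j 0 + (sg * z + 0) *: delta_mx 0 j.
  apply/rowP => i; rewrite !mxE eqxx /= addr0 eq_sym.
  by case: (j == i); rewrite ?mulr1 ?mulr0 ?addr0.
have h := partials_line flow J j (x0 + sg *: upd y j 0) (sg * s + 0) tT.
have {}h := der_inZ (sg ^+ size J) (der_in_affine (lt0r_neq0 sg0) h).
rewrite /rescaled E [sg ^+ size (j :: J)]exprSr -mulrA.
by apply: der_in_ext h => // z _; rewrite -E.
Qed.

Lemma rescaled_bounded J : exists2 M : R, 0 <= M & forall tau y,
  0 <= tau <= T / sg ^+ 4 -> box y -> `|rescaled J tau y| <= M.
Proof.
have [M M0 H] := partials_bounded flow J; exists M => // tau y /rescaled_time tT by_.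
rewrite /rescaled normrM normrX (gtr0_norm sg0).
apply: (@le_trans _ _ `|partials J (u^~ (sg ^+ 4 * tau)) (x0 + sg *: y)|).
  by rewrite ler_piMl // exprn_ile1 // ltW.
apply: H => // i; rewrite !mxE.
have y1 : `|y 0 i| <= 1 by rewrite ler_norml by_.
have : `|sg * y 0 i| <= 1 by rewrite normrM gtr0_norm // mulr_ile1 // ltW.
by rewrite ler_norml; have := x0b i; lra.
Qed.

(** Taylor's formula by two applications of the mean value theorem; the quadratic error comes from
    the uniform bound on the second derivative in direction j. *)
Lemma rescaled_dif J j : dif j
  (fun (p : {t : R | 0 <= t <= T / sg ^+ 4}) => rescaled J (sval p))
  (fun p => rescaled (j :: J) (sval p)).
Proof.
have [M0 M00 H0] := rescaled_bounded J.
have [M1 M10 H1] := rescaled_bounded (j :: J).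
have [M2 M20 H2] := rescaled_bounded [:: j, j & J].
exists (M0 + M1 + M2) => -[tau tT] y yb /=.
split; [by apply: le_trans (H0 _ _ tT yb) _; lra|
  by apply: le_trans (H1 _ _ tT yb) _; lra|move=> z zb].
have iT : is_interval (@setT R) by [].
have [th th01 [_ E]] := der_in_mvt iT (fun s _ => rescaled_line J j y s tT)
  (I : setT (y 0 j)) (I : setT z).
set c := y 0 j + _ in E.
have [et et01 [_ E']] := der_in_mvt iT (fun s _ => rescaled_line (j :: J) j y s tT)
  (I : setT (y 0 j)) (I : setT c).
set c' := y 0 j + _ in E'; rewrite !upd_id in E E'.
have yj := yb j.
have cb : -1 <= c <= 1 by rewrite /c; nra.
have cb' : -1 <= c' <= 1 by rewrite /c'; nra.
have := H2 _ _ tT (box_upd j yb cb').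
set Q := rescaled [:: j, j & J] _ _ in E' * => QM.
have cy : c - y 0 j = th * (z - y 0 j) by rewrite /c; ring.
have -> : rescaled J tau (upd y j z) - rescaled J tau y -
    (z - y 0 j) * rescaled (j :: J) tau y = Q * (th * (z - y 0 j) ^+ 2).
  rewrite E -[rescaled (j :: J) tau (upd y j c)](subrK (rescaled (j :: J) tau y)) E' cy.
  by ring.
have A0 := sqr_ge0 (z - y 0 j); case/andP: th01 => th0 th1.
have A1 := mulr_ge0 th0 A0; rewrite normrM (ger0_norm A1).
apply: ler_pM => //; [lra|exact: ler_piMl].
Qed.

Lemma rescaled_heat_tower : heat_tower (T / sg ^+ 4) rescaled.
Proof.
have s40 : 0 < sg ^+ 4 by rewrite exprn_gt0.
split; first split=> [J j|J k l [tau tT] y /=].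
- exact: rescaled_dif.
- by rewrite /rescaled (partials_swap flow J k l (rescaled_time tT)).
move=> J y; have D tau : 0 <= tau <= T / sg ^+ 4 ->
    der_in `[0, T / sg ^+ 4]%classic (fun t => rescaled J t y) tau (bih rescaled J tau y).
  move=> tT; have tT' : 0 <= sg ^+ 4 * tau + 0 <= T by rewrite addr0; exact: rescaled_time.
  have h := partials_time flow J (x0 + sg *: y) tT'.
  have {}h := der_inZ (sg ^+ size J) (der_in_affine (lt0r_neq0 s40) h).
  have -> : bih rescaled J tau y = sg ^+ size J * (sg ^+ 4 *
      - (\sum_k \sum_l partials [:: k, k, l, l & J] (u^~ (sg ^+ 4 * tau + 0)) (x0 + sg *: y))).
    rewrite /bih mulrA mulrN; congr (- _); rewrite mulr_sumr; apply: eq_bigr => k _.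
    rewrite mulr_sumr; apply: eq_bigr => l _; rewrite /rescaled addr0 -exprD.
    by rewrite addnC.
  apply: (@der_in_ext _ _ (fun r =>
    sg ^+ size J * partials J (u^~ (sg ^+ 4 * r + 0)) (x0 + sg *: y))).
  - by move=> r _; rewrite addr0.
  - by rewrite /= in_itv.
  apply: der_in_subset h => r; rewrite /= !in_itv /= addr0; exact: rescaled_time.
split=> t tT; first by apply: der_in_cvg; [rewrite /= in_itv|exact: D].
apply: (@der_in_is_derive _ `[0, T / sg ^+ 4]%classic); last first.
  by apply: D; case/andP: tT => ? ?; rewrite !ltW.
have tT' : t \in `]0, T / sg ^+ 4[ by rewrite in_itv.
by apply: filterS (near_in_itvoo tT') => z; exact: subset_itv_oo_cc.
Qed.

Lemma gsq_rescaled i tau y : gsq rescaled i tau y =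
  sg ^+ (2 * i) * grad_norm i (u^~ (sg ^+ 4 * tau)) (x0 + sg *: y) ^+ 2.
Proof.
rewrite /grad_norm sqr_sqrtr; last by apply: sumr_ge0 => J _; exact: sqr_ge0.
rewrite mulr_sumr; apply: eq_bigr => J _.
by rewrite /rescaled exprMn -exprM size_tuple mulnC.
Qed.

Lemma grad_norm_rescaled s r tau : (0 < r <= s)%N ->
  grad_norm r (u^~ (sg ^+ 4 * tau)) x0 <= asum rescaled s tau 0 / sg ^+ r.
Proof.
move=> /andP[r0 rs]; rewrite ler_pdivlMr ?exprn_gt0 // mulrC.
have sr : 0 <= sg ^+ r by rewrite exprn_ge0 // ltW.
have r1s : (r.-1 < s)%N by rewrite prednK.
rewrite /asum (bigD1 (Ordinal r1s)) //= prednK //.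
rewrite ler_wpDr //; first by apply: sumr_ge0 => i _; exact: sumr_ge0.
have -> : \sum_(J : r.-tuple 'I_n) `|rescaled J tau 0| =
    sg ^+ r * \sum_(J : r.-tuple 'I_n) `|partials J (u^~ (sg ^+ 4 * tau)) x0|.
  rewrite mulr_sumr; apply: eq_bigr => J _.
  by rewrite /rescaled scaler0 addr0 normrM size_tuple ger0_norm.
by rewrite ler_wpM2l // sqrt_sum_sq_le.
Qed.

End Rescaling.

(** * Gradient sums and the choice of N *)

Section Assembly.
Context {R : realType} {n : nat}.

(** With b = t^(1/4) the last term of the hypothesis reads (b |nabla f|)^s <= k0. If the base
    exceeds 1, its square is at most its s-th power, as s >= 2; otherwise the square is at most 1.
    No root of k0 is taken. *)
Lemma sqrtM_grad_norm_le (s : nat) (k0 t : R) (f : 'rV[R]_n -> R) x : (2 <= s)%N ->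
  0 <= t -> t `^ (s%:R / 4) * grad_sum s f x <= k0 ->
  Num.sqrt t * grad_norm 1 f x ^+ 2 <= 1 + `|k0|.
Proof.
move=> s2 t0 h; set g := grad_norm 1 f x; pose b := t `^ 4^-1.
have g0 : 0 <= g := sqrtr_ge0 _; have b0 : 0 <= b := powR_ge0 _ _.
have -> : Num.sqrt t = b ^+ 2.
  by rewrite -powR12_sqrt // -powR_mulrn // -powRrM; congr (_ `^ _); field.
rewrite -exprMn; have bg : 0 <= b * g by exact: mulr_ge0.
have [bg1|/ltW bg1] := leP (b * g) 1.
  by apply: (@le_trans _ _ 1); rewrite ?exprn_ile1 // lerDl.
apply: (@le_trans _ _ ((b * g) ^+ s)); first exact: ler_weXn2l.
apply: (@le_trans _ _ k0); last by rewrite (le_trans (ler_norm _)) // lerDr.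
apply: le_trans h; rewrite exprMn mulrC (mulrC (t `^ _)).
have -> : t `^ (s%:R / 4) = b ^+ s by rewrite mulrC powRrM powR_mulrn.
rewrite ler_wpM2r ?exprn_ge0 // /grad_sum big_ltn ?ltnS ?(leq_trans _ s2) //.
rewrite divr1 powR_mulrn // lerDl; apply: sumr_ge0 => i _; exact: powR_ge0.
Qed.

(** The exponents s / r make all terms homogeneous of degree s: each is at most D^s. *)
Lemma grad_sum_le (s : nat) (D : R) (f : 'rV[R]_n -> R) x : 0 <= D ->
  (forall r, (0 < r <= s)%N -> grad_norm r f x <= D ^+ r) ->
  grad_sum s f x <= s%:R * D ^+ s.
Proof.
move=> D0 h; rewrite /grad_sum.
have -> : s%:R * D ^+ s = \sum_(1 <= r < s.+1) D ^+ s.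
  by rewrite sumr_const_nat subSS subn0 mulr_natl.
apply: ler_sum_nat => r /andP[r0 rs].
have -> : D ^+ s = (D ^+ r) `^ (s%:R / r%:R).
  rewrite -!powR_mulrn // -powRrM; congr (_ `^ _).
  by rewrite mulrCA divff ?mulr1 // pnatr_eq0 -lt0n.
apply: ge0_ler_powR; rewrite ?nnegrE ?divr_ge0 ?exprn_ge0 ?sqrtr_ge0 //.
by apply: h; rewrite r0.
Qed.

End Assembly.

Unset Implicit Arguments.

Theorem theorem1p2 (R : realType) (n s : nat) (hs : (2 <= s)%N) (k0 k1 : R) :
  exists N : R, 0 < N /\
    forall (T : R) (u : 'rV[R]_n -> R -> R),
      0 < T ->
      biharmonic_heat_flow T u ->
      (forall (x : 'rV[R]_n) (t : R), 0 <= t <= T ->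
         t `^ (s%:R / 4) * grad_sum s (u^~ t) x <= k0) ->
      (ereal_sup [set (\sum_(0 <= i < (2 * n + s + 1).+1)
                         grad_norm i (u^~ 0) x ^+ 2)%:E | x in eball 0 1]
         <= k1%:E)%E ->
      forall (x : 'rV[R]_n) (t : R),
        closure (eball 0 1) x ->
        N * t <= (1 - enorm x) ^+ 4 ->
        t <= 1 / N ->
        0 <= t <= T ->
        ((grad_sum s (u^~ t) x)%:E <= N%:E / ((1 - enorm x) ^+ s)%:E)%E.
Proof.
have [s' sE] : exists s', s = s'.+1 by exists s.-1; rewrite prednK // (leq_trans _ hs).
have [C HC] := @heat_tower_bound R n s' (1 + `|k0|) `|k1|
  (addr_ge0 ler01 (normr_ge0 _)) (normr_ge0 _).
pose C1 := `|C| + 1; have C11 : 1 <= C1 by rewrite /C1 lerDr.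
pose m : R := n.+1%:R; have m0 : 0 < m by rewrite ltr0n.
have m1 : 1 <= m by rewrite ler1n.
(* The first summand is the constant of the final bound; the second turns N t <= (1 - |x|)^4 into t
   <= sg^4, that is, rescaled time at most 1. *)
pose N := s%:R * (C1 * m) ^+ s + m ^+ 4.
have C10 : 0 <= C1 := le_trans ler01 C11.
have Cm0 : 0 <= s%:R * (C1 * m) ^+ s.
  by rewrite mulr_ge0 ?ler0n // exprn_ge0 // mulr_ge0 // ltW.
have m40 : 0 < m ^+ 4 by rewrite exprn_gt0.
have N0 : 0 < N by rewrite ltr_wpDl.
exists N; split=> // T u T0 flow hk0 hk1 x t /closure_eball x1 Nt _ tT.
(* On the unit sphere the right-hand side is N / 0, which is +oo. *)
have [x1e|xlt1] := eqVneq (enorm x) 1.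
  rewrite x1e subrr expr0n -[s]prednK ?(leq_trans _ hs) //= inver eqxx gt0_muley ?lte_fin //.
  exact: leey.
pose rho := 1 - enorm x; have rho0 : 0 < rho by rewrite subr_gt0 lt_neqAle xlt1.
have rho1 : rho <= 1 by rewrite lerBlDr lerDl enorm_ge0.
pose sg := rho / m; have sg0 : 0 < sg by rewrite divr_gt0.
have sgm : sg * m = rho by rewrite /sg divfK // gt_eqF.
have sg1 : sg <= 1 by rewrite ler_pdivrMr // mul1r (le_trans rho1).
have xb : box x by move=> i; rewrite -ler_norml (le_trans (entry_le_enorm x i)).
have s40 : 0 < sg ^+ 4 by rewrite exprn_gt0.
have rho_s4 : rho ^+ 4 = sg ^+ 4 * m ^+ 4 by rewrite -sgm exprMn.
pose tau := t / sg ^+ 4; have tauE : sg ^+ 4 * tau = t by rewrite mulrC divfK // gt_eqF.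
have tauT : 0 <= tau <= T / sg ^+ 4.
  by case/andP: tT => t0 tT; rewrite divr_ge0 ?(ltW s40) //= ler_pM2r // invr_gt0.
have tau1 : tau <= 1.
  rewrite ler_pdivrMr // mul1r -(ler_pM2l m40) (mulrC _ (sg ^+ 4)) -rho_s4.
  apply: le_trans Nt; rewrite ler_wpM2r //; first by case/andP: tT.
  by rewrite lerDr.
have bound : asum (rescaled u x sg) s tau 0 <= C.
  rewrite sE; apply: (HC _ _ (rescaled_heat_tower flow sg0 sg1 xb)) => //.
  - move=> y r yb /andP[r0 rT]; have rT' : 0 <= r <= T / sg ^+ 4 by rewrite (ltW r0).
    have [t0 _] := andP (rescaled_time sg0 rT').
    have := sqrtM_grad_norm_le hs t0 (hk0 (x + sg *: y) _ (rescaled_time sg0 rT')).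
    (* The factor sg^2 is exactly that of the squared rescaled gradient, so the bound carries over
       with the same constant. *)
    have -> : Num.sqrt (sg ^+ 4 * r) = sg ^+ 2 * Num.sqrt r.
      by rewrite sqrtrM ?(ltW s40) // -[4%N]/(2 * 2)%N exprM sqrtr_sqr ger0_norm // sqr_ge0.
    by rewrite gsq_rescaled muln1 => h; rewrite mulrA (mulrC (Num.sqrt r)).
  move=> i y yb iN; rewrite gsq_rescaled mulr0.
  set g := grad_norm i _ _; have g0 : 0 <= g ^+ 2 := sqr_ge0 _.
  apply: (@le_trans _ _ (g ^+ 2)).
    by rewrite ler_piMl // exprn_ile1 // ltW.
  apply: (@le_trans _ _ k1); last exact: ler_norm.
  (* The displacement has length at most n sg, which is less than (n + 1) sg = 1 - |x|. *)
  have ball1 : eball 0 1 (x + sg *: y).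
    rewrite /eball /= subr0; apply: le_lt_trans (enormD _ _) _.
    have : \sum_i `|(sg *: y) 0 i| <= \sum_(i < n) sg.
      apply: ler_sum => k _; rewrite mxE normrM (gtr0_norm sg0) ler_piMr ?(ltW sg0) //.
      by rewrite ler_norml yb.
    rewrite sumr_const card_ord -mulr_natr.
    have : sg * m = sg * n%:R + sg by rewrite /m -natr1 mulrDr mulr1.
    rewrite sgm /rho; lra.
  have := le_trans (ereal_sup_ubound (imageP _ ball1)) hk1.
  rewrite lee_fin; apply: le_trans.
  rewrite (bigD1_seq i) ?mem_index_iota ?iota_uniq //=; last first.
    rewrite ltnS (leq_trans iN) // -sE mulSn mul1n addnC -!addnA leq_add2l.
    by rewrite addnCA leq_addr.
  by rewrite lerDl; apply: sumr_ge0 => *; exact: sqr_ge0.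
have D0 : 0 <= C1 / sg by rewrite divr_ge0 // ltW.
have gs : grad_sum s (u^~ t) x <= s%:R * (C1 / sg) ^+ s.
  apply: grad_sum_le => // r rs; rewrite -tauE.
  apply: le_trans (grad_norm_rescaled u x sg0 tau rs) _.
  rewrite [leRHS]expr_div_n ler_pM2r ?invr_gt0 ?exprn_gt0 //.
  apply: le_trans bound _; apply: (@le_trans _ _ C1).
    by rewrite /C1; have := ler_norm C; lra.
  (* C1 >= 1 and r >= 1 give C1 <= C1^r, so all orders fit the form D^r with D = C1 / sg. *)
  by case/andP: rs => r0 _; exact: ler_eXnr.
rewrite inver gt_eqF ?exprn_gt0 // -EFinM lee_fin.
apply: le_trans gs _; rewrite -/rho.
have -> : C1 / sg = C1 * m / rho by rewrite -sgm; field; rewrite !gt_eqF.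
rewrite expr_div_n mulrA ler_pM2r ?invr_gt0 ?exprn_gt0 //.
by rewrite lerDl ltW.
Qed.
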